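(* Let $f(z)=\sum_{k=0}^{\infty}a_kz^k$ and $g(z)=\sum_{k=0}^{\infty}b_kz^k$ be analytic in $\mathbb{D}$. Suppose there exist $\Phi\in\mathcal{B}$ and $\omega\in\mathcal{B}$ with $\omega(0)=0$ such that $f(z)=\Phi(z)\,g(\omega(z))$ for all $z\in\mathbb{D}$. Then $$\sum_{k=0}^{\infty}|a_k|r^k\le\sum_{k=0}^{\infty}|b_k|r^k\qquad\text{for } 0\le r\le\min\{r_1(|\Phi(0)|),\,r_1(|\omega'(0)|)\}.$$
   Context: $\mathbb{D}=\{z\in\mathbb{C}:|z|<1\}$, and $\mathcal{B}$ is the set of all analytic functions $f$ in $\mathbb{D}$ with $|f(z)|\le1$ for all $z\in\mathbb{D}$. The function $r_1:[0,1]\to\mathbb{R}$ is defined by $$r_1(x)=\begin{cases}\sqrt{\dfrac{1-x}{2}}, & x\in[0,\tfrac12),\\[2mm] \dfrac{1}{1+2x}, & x\in[\tfrac12,1].\end{cases}$$ *)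

(* Defs.v *)
From Stdlib Require Import Reals.
From Coquelicot Require Import Coquelicot.
Open Scope R_scope.

(* Analyticity is complex differentiability at every point of the open unit
   disc.  The disc is open, so the values of the total function [f] outside it
   are irrelevant. *)
Definition analytic_in_disc (f : C -> C) : Prop :=
  forall z : C, Cmod z < 1 -> ex_derive (K := C_AbsRing) (V := C_NormedModule) f z.

Definition class_B (f : C -> C) : Prop :=
  analytic_in_disc f /\ forall z : C, Cmod z < 1 -> Cmod (f z) <= 1.

Definition has_expansion (f : C -> C) (a : nat -> C) : Prop :=
  forall z : C, Cmod z < 1 ->
    is_pseries (K := C_AbsRing) (V := C_NormedModule) a z (f z).

(* Only the values on [0, 1] are meaningful. *)
Definition r1 (x : R) : R :=
  if Rlt_dec x (1 / 2) then sqrt ((1 - x) / 2) else 1 / (1 + 2 * x).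

(* Main.v *)
Require Import Defs.
From Stdlib Require Import Reals Lra Lia Psatz.
From Coquelicot Require Import Coquelicot.
Open Scope R_scope.

(* Goursat's bisection shows that the circular mean of a holomorphic function does not depend
   on the radius; Cauchy's formula, the maximum principle and Schwarz's lemma follow.
   For [|F| <= 1] with [p = F 0], Schwarz's lemma gives
   [|F z - p| <= |z| |1 - conj p F z|]; taking quadratic means yields
   [sum_(k >= 1) |c_k|^2 q^k <= q (1 - |p|^2)^2 / (1 - q |p|^2)] for [q < 1], and letting
   [q] depend on [r], the Cauchy-Schwarz inequality gives [sum_k |c_k| r^k <= 1] for
   [r <= r1 |p|].  This applies to [Phi] and to [psi z = omega z / z].  Majorant sums are
   submultiplicative, so writing [g w = b_0 + w g_1 w], i.e.
   [Phi (g o omega) = b_0 Phi + z (psi Phi) (g_1 o omega)], the theorem follows by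
   induction on the length of the partial sums. *)

(** * Complex differentiability *)

(** Quotients such as [omega z / z] have no meaningful value at 0. Analytic functions are therefore
    handled on the punctured disc, and coefficients are read off as circular means; only [f], [g]
    and the shifts of [g] are treated as power series. The branches of [r1] come from two choices of
    the weight [q]: with [x = |p|], the value [q = 1] leads to the condition [2 r^2 <= 1 - x], and
    [q = r / x], which maximises [(1 - q x^2) (1 - r^2 / q)], leads to [r (1 + 2 x) <= 1]. *)

Definition ccont (F : C -> C) (z : C) : Prop :=
  forall eps, 0 < eps -> exists delta, 0 < delta /\
    forall w, Cmod (w - z) < delta -> Cmod (F w - F z) < eps.

(* Caratheodory's form of complex differentiability. *)
Definition cdiff (F : C -> C) (z : C) : Prop :=
  exists D, ccont D z /\ exists delta, 0 < delta /\
    forall w, Cmod (w - z) < delta -> (F w - F z = D w * (w - z))%C.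

Lemma Cmod_minus_sym (z w : C) : Cmod (z - w) = Cmod (w - z).
Proof. rewrite <- Cmod_opp. f_equal. ring. Qed.

Lemma Cmod_minus_0 (z : C) : Cmod (z - 0) = Cmod z.
Proof. f_equal; ring. Qed.

Lemma Cmod_neq_0 (z : C) : 0 < Cmod z -> z <> RtoC 0.
Proof. intros H ->. rewrite Cmod_0 in H. lra. Qed.

Lemma Cmod_triangle_minus (z w : C) : Cmod (z - w) <= Cmod z + Cmod w.
Proof.
  unfold Cminus. rewrite <- (Cmod_opp w). apply Cmod_triangle.
Qed.

Lemma Cmod_reverse_triangle (z w : C) : Cmod z - Cmod w <= Cmod (z - w).
Proof.
  pose proof (Cmod_triangle (z - w) w) as H.
  replace (z - w + w)%C with z in H by ring. lra.
Qed.

Lemma ccont_ext_loc (F G : C -> C) z delta : 0 < delta ->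
  (forall w, Cmod (w - z) < delta -> F w = G w) -> ccont F z -> ccont G z.
Proof.
  intros Hd HFG HF eps Heps.
  destruct (HF eps Heps) as [d [Hd0 Hd1]].
  exists (Rmin d delta); split; [now apply Rmin_pos|].
  intros w Hw.
  pose proof (Rmin_l d delta); pose proof (Rmin_r d delta).
  rewrite <- !HFG.
  - apply Hd1; lra.
  - replace (z - z)%C with (RtoC 0) by ring. now rewrite Cmod_0.
  - lra.
Qed.

Lemma ccont_const c z : ccont (fun _ => c) z.
Proof.
  intros eps Heps. exists 1; split; [lra|]. intros w _.
  replace (c - c)%C with (RtoC 0) by ring. now rewrite Cmod_0.
Qed.

Lemma ccont_id z : ccont (fun w => w) z.
Proof. intros eps Heps. exists eps; split; auto. Qed.

Lemma ccont_plus F G z : ccont F z -> ccont G z -> ccont (fun w => F w + G w)%C z.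
Proof.
  intros HF HG eps Heps.
  destruct (HF (eps / 2)) as [d [Hd0 Hd]]; [lra|].
  destruct (HG (eps / 2)) as [e [He0 He]]; [lra|].
  exists (Rmin d e); split; [now apply Rmin_pos|].
  intros w Hw.
  pose proof (Rmin_l d e); pose proof (Rmin_r d e).
  replace (F w + G w - (F z + G z))%C with ((F w - F z) + (G w - G z))%C by ring.
  pose proof (Cmod_triangle (F w - F z) (G w - G z)).
  specialize (Hd w ltac:(lra)). specialize (He w ltac:(lra)). lra.
Qed.

Lemma ccont_loc_bound F z : ccont F z -> exists delta, 0 < delta /\
  forall w, Cmod (w - z) < delta -> Cmod (F w) <= Cmod (F z) + 1.
Proof.
  intros HF. destruct (HF 1) as [d [Hd0 Hd]]; [lra|].
  exists d; split; auto. intros w Hw. specialize (Hd w Hw).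
  pose proof (Cmod_reverse_triangle (F w) (F z)). lra.
Qed.

Lemma ccont_mult F G z : ccont F z -> ccont G z -> ccont (fun w => F w * G w)%C z.
Proof.
  intros HF HG eps Heps.
  destruct (ccont_loc_bound F z HF) as [d0 [Hd00 Hd0]].
  set (A := Cmod (F z) + 1) in *. set (B := Cmod (G z) + 1).
  pose proof (Cmod_ge_0 (F z)). pose proof (Cmod_ge_0 (G z)).
  assert (0 < A) by (unfold A; lra). assert (0 < B) by (unfold B; lra).
  assert (H3 : 0 < eps / (2 * A)) by (apply Rdiv_lt_0_compat; lra).
  assert (H4 : 0 < eps / (2 * B)) by (apply Rdiv_lt_0_compat; lra).
  destruct (HF _ H4) as [d [Hd1 Hd]].
  destruct (HG _ H3) as [e [He1 He]].
  exists (Rmin d0 (Rmin d e)); split; [now repeat apply Rmin_pos|].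
  intros w Hw.
  pose proof (Rmin_l d0 (Rmin d e)); pose proof (Rmin_r d0 (Rmin d e)).
  pose proof (Rmin_l d e); pose proof (Rmin_r d e).
  replace (F w * G w - F z * G z)%C
    with (F w * (G w - G z) + (F w - F z) * G z)%C by ring.
  pose proof (Cmod_triangle (F w * (G w - G z)) ((F w - F z) * G z)) as HT.
  rewrite !Cmod_mult in HT.
  specialize (Hd0 w ltac:(lra)). specialize (Hd w ltac:(lra)).
  specialize (He w ltac:(lra)).
  assert (Cmod (F w) * Cmod (G w - G z) <= A * Cmod (G w - G z)).
  { apply Rmult_le_compat_r; auto. apply Cmod_ge_0. }
  assert (A * Cmod (G w - G z) < A * (eps / (2 * A))).
  { now apply Rmult_lt_compat_l. }
  assert (Cmod (F w - F z) * Cmod (G z) <= eps / (2 * B) * B).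
  { apply Rmult_le_compat; [apply Cmod_ge_0|apply Cmod_ge_0|lra|unfold B; lra]. }
  replace (A * (eps / (2 * A))) with (eps / 2) in * by (field; lra).
  replace (eps / (2 * B) * B) with (eps / 2) in * by (field; lra).
  lra.
Qed.

Lemma ccont_inv F z : F z <> RtoC 0 -> ccont F z -> ccont (fun w => / F w)%C z.
Proof.
  intros Hz HF eps Heps. apply Cmod_gt_0 in Hz.
  set (m := Cmod (F z)) in *.
  assert (Hm : 0 < Rmin (m / 2) (eps * (m * m / 2))).
  { apply Rmin_pos; [lra|]. apply Rmult_lt_0_compat; [lra|]. nra. }
  destruct (HF _ Hm) as [d [Hd0 Hd]].
  exists d; split; auto. intros w Hw. specialize (Hd w Hw).
  pose proof (Rmin_l (m / 2) (eps * (m * m / 2))).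
  pose proof (Rmin_r (m / 2) (eps * (m * m / 2))).
  assert (Hw2 : m / 2 < Cmod (F w)).
  { pose proof (Cmod_reverse_triangle (F z) (F w)).
    rewrite Cmod_minus_sym in H1. fold m in H1. lra. }
  assert (HFz : F z <> RtoC 0) by (apply Cmod_neq_0; auto).
  assert (HFw : F w <> RtoC 0) by (apply Cmod_neq_0; lra).
  replace (/ F w - / F z)%C with (- (F w - F z) / (F w * F z))%C
    by (field; auto).
  rewrite Cmod_div by (apply Cmult_neq_0; auto).
  rewrite Cmod_opp, Cmod_mult. fold m.
  apply Rmult_lt_reg_r with (Cmod (F w) * m); [nra|].
  unfold Rdiv. rewrite Rmult_assoc, Rinv_l by nra.
  rewrite Rmult_1_r.
  apply Rlt_le_trans with (eps * (m * m / 2)); [lra|].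
  apply Rmult_le_compat_l; [lra|]. nra.
Qed.

Lemma ccont_comp F G z : ccont F z -> ccont G (F z) -> ccont (fun w => G (F w)) z.
Proof.
  intros HF HG eps Heps.
  destruct (HG eps Heps) as [d [Hd0 Hd]].
  destruct (HF d Hd0) as [e [He0 He]].
  exists e; split; auto.
Qed.

Lemma cdiff_ccont F z : cdiff F z -> ccont F z.
Proof.
  intros [D [HD [delta [Hd0 Hd]]]].
  apply ccont_ext_loc with (fun w => F z + D w * (w + - z))%C delta; auto.
  { intros w Hw. replace (w + - z)%C with (w - z)%C by ring.
    rewrite <- Hd by auto. ring. }
  apply ccont_plus; [apply ccont_const|].
  apply ccont_mult; auto.
  apply ccont_plus; [apply ccont_id|apply ccont_const].
Qed.

Lemma cdiff_ext_loc F G z delta : 0 < delta ->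
  (forall w, Cmod (w - z) < delta -> F w = G w) -> cdiff F z -> cdiff G z.
Proof.
  intros Hd0 Hd [D [HD [e [He0 He]]]].
  exists D; split; auto. exists (Rmin delta e); split; [now apply Rmin_pos|].
  intros w Hw. pose proof (Rmin_l delta e); pose proof (Rmin_r delta e).
  rewrite <- !Hd.
  - apply He. lra.
  - replace (z - z)%C with (RtoC 0) by ring. now rewrite Cmod_0.
  - lra.
Qed.

Lemma cdiff_const c z : cdiff (fun _ => c) z.
Proof.
  exists (fun _ => RtoC 0). split; [apply ccont_const|].
  exists 1; split; [lra|]. intros; ring.
Qed.

Lemma cdiff_id z : cdiff (fun w => w) z.
Proof.
  exists (fun _ => RtoC 1). split; [apply ccont_const|].
  exists 1; split; [lra|]. intros; ring.
Qed.

Lemma cdiff_plus F G z : cdiff F z -> cdiff G z -> cdiff (fun w => F w + G w)%C z.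
Proof.
  intros [D [HD [d [Hd0 Hd]]]] [E [HE [e [He0 He]]]].
  exists (fun w => D w + E w)%C. split; [now apply ccont_plus|].
  exists (Rmin d e); split; [now apply Rmin_pos|]. intros w Hw.
  pose proof (Rmin_l d e); pose proof (Rmin_r d e).
  replace (F w + G w - (F z + G z))%C with ((F w - F z) + (G w - G z))%C by ring.
  rewrite Hd, He by lra. ring.
Qed.

Lemma cdiff_mult F G z : cdiff F z -> cdiff G z -> cdiff (fun w => F w * G w)%C z.
Proof.
  intros HF HG. pose proof (cdiff_ccont _ _ HG) as HGc.
  destruct HF as [D [HD [d [Hd0 Hd]]]]. destruct HG as [E [HE [e [He0 He]]]].
  exists (fun w => D w * G w + F z * E w)%C. split.
  { apply ccont_plus; apply ccont_mult; auto. apply ccont_const. }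
  exists (Rmin d e); split; [now apply Rmin_pos|]. intros w Hw.
  pose proof (Rmin_l d e); pose proof (Rmin_r d e).
  replace (F w * G w - F z * G z)%C
    with ((F w - F z) * G w + F z * (G w - G z))%C by ring.
  rewrite Hd, He by lra. ring.
Qed.

Lemma cdiff_minus F G z : cdiff F z -> cdiff G z -> cdiff (fun w => F w - G w)%C z.
Proof.
  intros HF HG. apply cdiff_ext_loc with (fun w => F w + - (1) * G w)%C 1; [lra| |].
  - intros; ring.
  - apply cdiff_plus; auto. apply cdiff_mult; auto. apply cdiff_const.
Qed.

Lemma cdiff_inv F z : F z <> RtoC 0 -> cdiff F z -> cdiff (fun w => / F w)%C z.
Proof.
  intros Hz HF. pose proof (cdiff_ccont _ _ HF) as HFc.
  destruct HF as [D [HD [d [Hd0 Hd]]]].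
  exists (fun w => - / F z * (D w * / F w))%C. split.
  { apply ccont_mult; [apply ccont_const|].
    apply ccont_mult; auto. now apply ccont_inv. }
  destruct (HFc (Cmod (F z))) as [e [He0 He]]; [now apply Cmod_gt_0|].
  exists (Rmin d e); split; [now apply Rmin_pos|]. intros w Hw.
  pose proof (Rmin_l d e); pose proof (Rmin_r d e).
  assert (HFw : F w <> RtoC 0).
  { intros E. specialize (He w ltac:(lra)). rewrite E in He.
    replace (0 - F z)%C with (- F z)%C in He by ring.
    rewrite Cmod_opp in He. lra. }
  transitivity (- (F w - F z) * / F z * / F w)%C; [field; auto|].
  rewrite Hd by lra. ring.
Qed.

Lemma cdiff_div F G z : G z <> RtoC 0 -> cdiff F z -> cdiff G z ->
  cdiff (fun w => F w / G w)%C z.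
Proof. intros. apply cdiff_mult; auto. now apply cdiff_inv. Qed.

Lemma cdiff_comp F G z : cdiff F z -> cdiff G (F z) -> cdiff (fun w => G (F w)) z.
Proof.
  intros HF HG. pose proof (cdiff_ccont _ _ HF) as HFc.
  destruct HF as [D [HD [d [Hd0 Hd]]]]. destruct HG as [E [HE [e [He0 He]]]].
  exists (fun w => E (F w) * D w)%C. split.
  { apply ccont_mult; auto. now apply ccont_comp. }
  destruct (HFc e He0) as [k [Hk0 Hk]].
  exists (Rmin d k); split; [now apply Rmin_pos|]. intros w Hw.
  pose proof (Rmin_l d k); pose proof (Rmin_r d k).
  rewrite He by (apply Hk; lra). rewrite Hd by lra. ring.
Qed.

Lemma cdiff_pow F z n : cdiff F z -> cdiff (fun w => Cpow (F w) n) z.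
Proof.
  intros HF. induction n as [|n IH]; simpl.
  - apply cdiff_const.
  - now apply cdiff_mult.
Qed.

Lemma cdiff_affine_approx F z : cdiff F z -> exists l, forall eps, 0 < eps ->
  exists delta, 0 < delta /\ forall w, Cmod (w - z) < delta ->
    Cmod (F w - (F z + l * (w - z))) <= eps * Cmod (w - z).
Proof.
  intros [D [HD [d [Hd0 Hd]]]]. exists (D z). intros eps Heps.
  destruct (HD eps Heps) as [e [He0 He]].
  exists (Rmin d e); split; [now apply Rmin_pos|]. intros w Hw.
  pose proof (Rmin_l d e); pose proof (Rmin_r d e).
  replace (F w - (F z + D z * (w - z)))%C with ((F w - F z) - D z * (w - z))%C by ring.
  rewrite Hd by lra.
  replace (D w * (w - z) - D z * (w - z))%C with ((D w - D z) * (w - z))%C by ring.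
  rewrite Cmod_mult. apply Rmult_le_compat_r; [apply Cmod_ge_0|].
  left. apply He. lra.
Qed.

(** The difference quotient, completed by the derivative at [z], is the slope function that [cdiff]
    asks for. It also serves later to identify [omega'(0)] as a limit. *)
Lemma is_derive_quotient_lim (F : C -> C) (z l : C) :
  is_derive (K := C_AbsRing) (V := C_NormedModule) F z l ->
  ccont (fun w => if Ceq_dec w z then l else (F w - F z) / (w - z))%C z.
Proof.
  intros [_ H] eps Heps.
  assert (Heps2 : 0 < eps / 2) by lra.
  specialize (H z (fun P HP => HP) (mkposreal _ Heps2)). simpl in H.
  destruct H as [d Hd]. exists d; split; [apply cond_pos|].
  intros w Hw. specialize (Hd w Hw). simpl in Hd.
  destruct (Ceq_dec z z) as [_|n]; [|now elim n].
  destruct (Ceq_dec w z) as [->|Hwz].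
  - replace (l - l)%C with (RtoC 0) by ring. now rewrite Cmod_0.
  - assert (Hne : (w - z)%C <> RtoC 0).
    { intros E. apply Hwz. replace w with (w - z + z)%C by ring. rewrite E. ring. }
    change (Cmod ((F w - F z) - (w - z) * l) <= eps / 2 * Cmod (w - z)) in Hd.
    replace ((F w - F z) / (w - z) - l)%C
      with (((F w - F z) - (w - z) * l) / (w - z))%C by (field; auto).
    rewrite Cmod_div by auto. apply Cmod_gt_0 in Hne.
    apply Rmult_lt_reg_r with (Cmod (w - z)); auto.
    unfold Rdiv. rewrite Rmult_assoc, Rinv_l by lra. nra.
Qed.

Lemma ex_derive_cdiff (F : C -> C) (z : C) :
  ex_derive (K := C_AbsRing) (V := C_NormedModule) F z -> cdiff F z.
Proof.
  intros [l Hl]. apply is_derive_quotient_lim in Hl.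
  eexists; split; [exact Hl|]. exists 1; split; [lra|].
  intros w _. destruct (Ceq_dec w z) as [->|Hwz]; [ring|].
  field. intros E. apply Hwz. replace w with (w - z + z)%C by ring. rewrite E. ring.
Qed.

(** * Goursat's lemma for polar rectangles *)

Definition pt (rho t : R) : C := (rho * cos t, rho * sin t).

Lemma Cmod_pt rho t : 0 <= rho -> Cmod (pt rho t) = rho.
Proof.
  intros H. unfold pt, Cmod; simpl.
  replace (rho * cos t * (rho * cos t * 1) + rho * sin t * (rho * sin t * 1))
    with (rho * rho * ((sin t)² + (cos t)²)) by (unfold Rsqr; ring).
  rewrite sin2_cos2, Rmult_1_r. now apply sqrt_square.
Qed.

Lemma Cmod_le_Re_Im (z : C) : Cmod z <= Rabs (Re z) + Rabs (Im z).
Proof.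
  destruct z as [x y]. simpl.
  replace (x, y) with (RtoC x + Ci * RtoC y)%C
    by (apply injective_projections; simpl; ring).
  eapply Rle_trans; [apply Cmod_triangle|].
  rewrite Cmod_mult, Cmod_Ci, !Cmod_R. simpl.
  apply Req_le; ring.
Qed.

Lemma Im_le_Cmod (z : C) : Rabs (Im z) <= Cmod z.
Proof.
  eapply Rle_trans; [|apply Rmax_Cmod]. apply Rmax_r.
Qed.

Lemma cos_lipschitz t u : Rabs (cos t - cos u) <= Rabs (t - u).
Proof.
  destruct (MVT_gen cos u t (fun x => - sin x)) as [c [_ H]].
  - intros x _. auto_derive; [easy|ring].
  - intros x _. apply continuity_cos.
  - rewrite H, Rabs_mult. pose proof (SIN_bound c). pose proof (Rabs_pos (t - u)).
    assert (Rabs (- sin c) <= 1) by (apply Rabs_le; lra). nra.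
Qed.

Lemma sin_lipschitz t u : Rabs (sin t - sin u) <= Rabs (t - u).
Proof.
  destruct (MVT_gen sin u t cos) as [c [_ H]].
  - intros x _. auto_derive; [easy|ring].
  - intros x _. apply continuity_sin.
  - rewrite H, Rabs_mult. pose proof (COS_bound c). pose proof (Rabs_pos (t - u)).
    assert (Rabs (cos c) <= 1) by (apply Rabs_le; lra). nra.
Qed.

(** Split [r e^(it) - s e^(iu)] as [(r - s) e^(it) + s (e^(it) - e^(iu))]; the factor 2 comes from
    bounding the last modulus by its real and imaginary parts. *)
Lemma pt_lipschitz r t s u :
  Cmod (pt r t - pt s u) <= Rabs (r - s) + 2 * Rabs s * Rabs (t - u).
Proof.
  replace (pt r t - pt s u)%C
    with (RtoC (r - s) * pt 1 t + RtoC s * (pt 1 t - pt 1 u))%C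
    by (apply injective_projections; simpl; ring).
  eapply Rle_trans; [apply Cmod_triangle|].
  rewrite !Cmod_mult, !Cmod_R, Cmod_pt by lra.
  pose proof (Cmod_le_Re_Im (pt 1 t - pt 1 u)) as H. simpl in H.
  rewrite !Rmult_1_l in H.
  pose proof (cos_lipschitz t u). pose proof (sin_lipschitz t u).
  unfold Rminus in *. pose proof (Rabs_pos s).
  pose proof (Rabs_pos (t + - u)). nra.
Qed.

(** Joint continuity in polar coordinates yields integrability along arcs and along rays, and
    uniformity in the angle when the radius moves. *)
Lemma ccont_2d (F : C -> C) r t : ccont F (pt r t) ->
  continuity_2d_pt (fun x y => Re (F (pt x y))) r t /\
  continuity_2d_pt (fun x y => Im (F (pt x y))) r t.
Proof.
  intros HF.
  assert (K : forall eps : posreal, locally_2d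
    (fun x y => Cmod (F (pt x y) - F (pt r t)) < eps) r t).
  { intros [eps Heps]. destruct (HF eps Heps) as [d [Hd0 Hd]].
    pose proof (Rabs_pos r).
    assert (He : 0 < d / (1 + 2 * Rabs r)) by (apply Rdiv_lt_0_compat; lra).
    exists (mkposreal _ He). intros x y Hx Hy. simpl in *. apply Hd.
    eapply Rle_lt_trans; [apply pt_lipschitz|].
    replace d with (d / (1 + 2 * Rabs r) + 2 * Rabs r * (d / (1 + 2 * Rabs r)))
      by (field; lra).
    apply Rplus_lt_le_compat; auto.
    apply Rmult_le_compat_l; lra. }
  split; intros eps; destruct (K eps) as [d Hd]; exists d; intros x y Hx Hy;
    specialize (Hd x y Hx Hy); (eapply Rle_lt_trans; [|exact Hd]).
  - exact (re_le_Cmod (F (pt x y) - F (pt r t))).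
  - exact (Im_le_Cmod (F (pt x y) - F (pt r t))).
Qed.

Lemma continuity_2d_snd f r t :
  continuity_2d_pt f r t -> continuous (fun y => f r y) t.
Proof.
  intros H. apply continuity_pt_filterlim.
  intros eps Heps. destruct (H (mkposreal _ Heps)) as [d Hd].
  exists d; split; [apply cond_pos|]. intros x [_ Hx].
  apply (Hd r x); auto. rewrite Rminus_eq_0, Rabs_R0. apply cond_pos.
Qed.

Lemma continuity_2d_fst f r t :
  continuity_2d_pt f r t -> continuous (fun x => f x t) r.
Proof.
  intros H. apply continuity_pt_filterlim.
  intros eps Heps. destruct (H (mkposreal _ Heps)) as [d Hd].
  exists d; split; [apply cond_pos|]. intros x [_ Hx].
  apply (Hd x t); auto. rewrite Rminus_eq_0, Rabs_R0. apply cond_pos.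
Qed.

Definition circ_cont F rho := forall t, ccont F (pt rho t).

Lemma ex_RInt_circ_Re F rho a b : circ_cont F rho ->
  ex_RInt (fun t => Re (F (pt rho t))) a b.
Proof.
  intros H. apply (ex_RInt_continuous (V := R_CompleteNormedModule)).
  intros t _. apply (continuity_2d_snd (fun x y => Re (F (pt x y)))).
  apply (ccont_2d F rho t (H t)).
Qed.

Lemma ex_RInt_circ_Im F rho a b : circ_cont F rho ->
  ex_RInt (fun t => Im (F (pt rho t))) a b.
Proof.
  intros H. apply (ex_RInt_continuous (V := R_CompleteNormedModule)).
  intros t _. apply (continuity_2d_snd (fun x y => Im (F (pt x y)))).
  apply (ccont_2d F rho t (H t)).
Qed.

Lemma ex_RInt_ray F r s t : 0 < r <= s ->
  (forall x, r <= x <= s -> ccont F (pt x t)) ->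
  ex_RInt (fun x => Im (F (pt x t)) / x) r s.
Proof.
  intros Hrs H. apply (ex_RInt_continuous (V := R_CompleteNormedModule)).
  intros x Hx. rewrite Rmin_left, Rmax_right in Hx by lra.
  apply (continuous_mult (K := R_AbsRing) (fun x => Im (F (pt x t))) (fun x => / x)).
  - apply (continuity_2d_fst (fun x y => Im (F (pt x y)))).
    apply (ccont_2d F x t (H x Hx)).
  - apply continuous_Rinv. lra.
Qed.

(* The real part of the integral of [F w / (i w) dw] over the boundary of the polar
   rectangle [r <= |w| <= s, a <= arg w <= b]. *)
Definition bd F r s a b : R :=
  (RInt (fun t => Re (F (pt s t))) a b - RInt (fun t => Re (F (pt r t))) a b)
  - (RInt (fun x => Im (F (pt x b)) / x) r s - RInt (fun x => Im (F (pt x a)) / x) r s).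

Definition ann_cont F A B := forall x t, A <= x <= B -> ccont F (pt x t).

Lemma bd_split F A B r s a b x t : 0 < A -> ann_cont F A B -> A <= r -> s <= B ->
  r <= x <= s -> a <= t <= b ->
  bd F r s a b = bd F r x a t + bd F r x t b + bd F x s a t + bd F x s t b.
Proof.
  intros HA HF Hr Hs Hx Ht. unfold bd.
  assert (HC : forall y u v w, A <= y <= B ->
    RInt (fun t => Re (F (pt y t))) u w =
    RInt (fun t => Re (F (pt y t))) u v + RInt (fun t => Re (F (pt y t))) v w).
  { intros. symmetry. apply (RInt_Chasles (V := R_CompleteNormedModule));
      apply ex_RInt_circ_Re; intros ?; apply HF; auto. }
  assert (HR : forall u, RInt (fun x => Im (F (pt x u)) / x) r s =
    RInt (fun x => Im (F (pt x u)) / x) r x + RInt (fun x => Im (F (pt x u)) / x) x s).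
  { intros. symmetry. apply (RInt_Chasles (V := R_CompleteNormedModule));
      apply ex_RInt_ray; try lra; intros; apply HF; lra. }
  rewrite (HC s a t b), (HC r a t b), !HR by lra. lra.
Qed.

Lemma bd_minus F G A B r s a b : 0 < A -> ann_cont F A B -> ann_cont G A B ->
  A <= r -> s <= B -> r <= s ->
  bd (fun w => F w - G w)%C r s a b = bd F r s a b - bd G r s a b.
Proof.
  intros HA HF HG Hr Hs Hrs. unfold bd.
  assert (HC : forall y, A <= y <= B ->
    RInt (fun t => Re (F (pt y t) - G (pt y t))%C) a b =
    RInt (fun t => Re (F (pt y t))) a b - RInt (fun t => Re (G (pt y t))) a b).
  { intros. rewrite <- (RInt_minus (V := R_CompleteNormedModule));
      [|apply ex_RInt_circ_Re; intros ?; auto ..].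
    apply RInt_ext. intros; reflexivity. }
  assert (HR : forall u, RInt (fun x => Im (F (pt x u) - G (pt x u))%C / x) r s =
    RInt (fun x => Im (F (pt x u)) / x) r s - RInt (fun x => Im (G (pt x u)) / x) r s).
  { intros. rewrite <- (RInt_minus (V := R_CompleteNormedModule));
      [|apply ex_RInt_ray; try lra; intros; auto; apply HF || apply HG; lra ..].
    apply RInt_ext. intros x _.
    change (Im (F (pt x u) - G (pt x u))%C) with (Im (F (pt x u)) - Im (G (pt x u))).
    unfold minus, plus, opp, Rdiv; simpl. ring. }
  rewrite !HC, !HR by lra. ring.
Qed.

(** The integrand [(c + l w) / (i w)] has a primitive built from [log w] and [w], and polar
    coordinates spare the choice of a branch. The logarithmic parts cancel between opposite sides,
    the others over the four corners. *)
Lemma bd_affine c l r s a b : 0 < r <= s -> bd (fun w => c + l * w)%C r s a b = 0.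
Proof.
  intros Hr. destruct c as [c d], l as [l m]. unfold bd. simpl.
  assert (H1 : forall x, RInt (fun t => c + (l * (x * cos t) - m * (x * sin t))) a b
    = (c * b + x * (l * sin b + m * cos b)) - (c * a + x * (l * sin a + m * cos a))).
  { intros x. apply is_RInt_unique.
    apply (is_RInt_derive (fun t => c * t + x * (l * sin t + m * cos t))).
    - intros t _. auto_derive; [easy|ring].
    - intros t _. apply (ex_derive_continuous (V := R_NormedModule)). now auto_derive. }
  assert (H2 : forall t, RInt (fun x => (d + (l * (x * sin t) + m * (x * cos t))) / x) r s
    = (d * ln s + s * (l * sin t + m * cos t)) - (d * ln r + r * (l * sin t + m * cos t))).
  { intros t. apply is_RInt_unique.
    apply (is_RInt_derive (fun x => d * ln x + x * (l * sin t + m * cos t))).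
    - intros x Hx. rewrite Rmin_left, Rmax_right in Hx by lra.
      auto_derive; [lra|field; lra].
    - intros x Hx. rewrite Rmin_left, Rmax_right in Hx by lra.
      apply (ex_derive_continuous (V := R_NormedModule)). auto_derive. lra. }
  rewrite !H1, !H2. ring.
Qed.

(** For [dw / (i w)] each arc has length [b - a], and each radial side at most [(s - r) / A]. *)
Lemma bd_bound F A B r s a b M : 0 < A -> ann_cont F A B ->
  A <= r -> s <= B -> r <= s -> a <= b ->
  (forall x t, r <= x <= s -> a <= t <= b -> Cmod (F (pt x t)) <= M) ->
  Rabs (bd F r s a b) <= 2 * M * ((b - a) + (s - r) / A).
Proof.
  intros HA HF Hr Hs Hrs Hab HM.
  assert (HM0 : 0 <= M).
  { eapply Rle_trans; [apply Cmod_ge_0|apply (HM r a); lra]. }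
  assert (HC : forall y, r <= y <= s ->
    Rabs (RInt (fun t => Re (F (pt y t))) a b) <= (b - a) * M).
  { intros y Hy. apply abs_RInt_le_const; auto.
    - apply ex_RInt_circ_Re. intros ?; apply HF; lra.
    - intros t Ht. eapply Rle_trans; [apply re_le_Cmod|auto]. }
  assert (HR : forall u, a <= u <= b ->
    Rabs (RInt (fun x => Im (F (pt x u)) / x) r s) <= (s - r) * (M / A)).
  { intros u Hu. apply abs_RInt_le_const; auto.
    - apply ex_RInt_ray; try lra. intros; apply HF; lra.
    - intros x Hx. unfold Rdiv. rewrite Rabs_mult.
      apply Rmult_le_compat; try apply Rabs_pos.
      + eapply Rle_trans; [apply Im_le_Cmod|auto].
      + rewrite Rabs_pos_eq; [apply Rinv_le_contravar; lra|].
        left; apply Rinv_0_lt_compat; lra. }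
  unfold bd.
  pose proof (HC s ltac:(lra)) as H1. pose proof (HC r ltac:(lra)) as H2.
  pose proof (HR a ltac:(lra)) as H3. pose proof (HR b ltac:(lra)) as H4.
  replace (2 * M * ((b - a) + (s - r) / A))
    with (2 * ((b - a) * M) + 2 * ((s - r) * (M / A))) by (field; lra).
  apply Rabs_le_between in H1, H2, H3, H4.
  apply Rabs_le. lra.
Qed.

Lemma nested_intervals (x : nat -> R) (L : R) : 0 <= L ->
  (forall n, x n <= x (S n) <= x n + L / 2 ^ S n) ->
  exists p, forall n, x n <= p <= x n + L / 2 ^ n.
Proof.
  intros HL Hx.
  assert (Hp : forall n, 0 < 2 ^ n) by (intros; apply pow_lt; lra).
  assert (Hup : forall n, x (S n) + L / 2 ^ S n <= x n + L / 2 ^ n).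
  { intros n. specialize (Hx n).
    replace (L / 2 ^ n) with (L / 2 ^ S n + L / 2 ^ S n); [lra|].
    simpl. field. specialize (Hp n). lra. }
  assert (Hmono : forall n k, x n <= x (k + n)%nat).
  { intros n k. induction k as [|k IH]; simpl; [lra|].
    specialize (Hx (k + n)%nat). lra. }
  assert (Hmono2 : forall n k, x (k + n)%nat + L / 2 ^ (k + n) <= x n + L / 2 ^ n).
  { intros n k. induction k as [|k IH]; cbn [Nat.add]; [lra|].
    specialize (Hup (k + n)%nat). lra. }
  assert (HL0 : forall n, 0 <= L / 2 ^ n).
  { intros n. apply Rdiv_le_0_compat; auto. }
  assert (Hub : forall n m, x m <= x n + L / 2 ^ n).
  { intros n m. specialize (Hmono m n). specialize (Hmono2 n m).
    specialize (HL0 (m + n)%nat). rewrite Nat.add_comm in Hmono. lra. }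
  destruct (completeness (fun y => exists n, y = x n)) as [p [Hp1 Hp2]].
  - exists (x 0%nat + L / 2 ^ 0). intros y [n ->]. apply Hub.
  - exists (x 0%nat). now exists 0%nat.
  - exists p. intros n. split.
    + apply Hp1. now exists n.
    + apply Hp2. intros y [m ->]. apply Hub.
Qed.

Lemma exists_pow_half_lt K eps : 0 < eps -> exists n, K / 2 ^ n < eps.
Proof.
  intros He.
  destruct (Pow_x_infinity 2 ltac:(rewrite Rabs_pos_eq; lra) ((Rabs K + 1) / eps)) as [N HN].
  exists N. specialize (HN N (Nat.le_refl N)).
  rewrite Rabs_pos_eq in HN by (apply pow_le; lra).
  assert (0 < 2 ^ N) by (apply pow_lt; lra).
  apply Rmult_lt_reg_r with (2 ^ N); auto.
  unfold Rdiv. rewrite Rmult_assoc, Rinv_l, Rmult_1_r by lra.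
  apply Rge_le in HN. apply Rle_div_l in HN; auto.
  pose proof (Rle_abs K). rewrite Rmult_comm. lra.
Qed.

Definition ann_diff F A B := forall z, A <= Cmod z <= B -> cdiff F z.

Lemma ann_diff_cont F A B : 0 < A -> ann_diff F A B -> ann_cont F A B.
Proof.
  intros HA H x t Hx. apply cdiff_ccont, H. rewrite Cmod_pt; lra.
Qed.

(** Polar rectangles are chosen because after a full turn the two radial sides coincide, so that a
    comparison of two circular means remains. In the bisection the affine approximation error is
    [eps] times a diameter of order [2^-n], and the boundary length is of order [2^-n]; the product
    contradicts the lower bound [q / 4^n]. *)
Lemma goursat F A B a b : 0 < A <= B -> a <= b -> ann_diff F A B ->
  bd F A B a b = 0.
Proof.
  intros HA Hab HF.
  assert (HFc : ann_cont F A B) by (apply ann_diff_cont; auto; lra).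
  set (q := Rabs (bd F A B a b)).
  set (dx := fun n => (B - A) / 2 ^ n). set (dt := fun n => (b - a) / 2 ^ n).
  assert (Hp : forall n, 0 < 2 ^ n) by (intros; apply pow_lt; lra).
  assert (Hdx0 : forall n, 0 <= dx n) by (intros; apply Rdiv_le_0_compat; auto; lra).
  assert (Hdt0 : forall n, 0 <= dt n) by (intros; apply Rdiv_le_0_compat; auto; lra).
  assert (HdxS : forall n, dx n = dx (S n) + dx (S n)).
  { intros n. unfold dx. simpl. field. specialize (Hp n). lra. }
  assert (HdtS : forall n, dt n = dt (S n) + dt (S n)).
  { intros n. unfold dt. simpl. field. specialize (Hp n). lra. }
  set (big := fun n x t => q / 4 ^ n <= Rabs (bd F x (x + dx n) t (t + dt n))).
  (* Keep the first quarter that passes the threshold [q / 4 ^ S n]. The last one is taken untested: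
     if the other three fail, the triangle inequality forces it to pass. *)
  set (next := fun n (p : R * R) => let (x, t) := p in
    let x' := x + dx (S n) in let t' := t + dt (S n) in
    let test u v := Rle_dec (q / 4 ^ S n) (Rabs (bd F u (u + dx (S n)) v (v + dt (S n)))) in
    if test x t then (x, t) else if test x' t then (x', t)
    else if test x t' then (x, t') else (x', t')).
  set (p := fix p n := match n with O => (A, a) | S n => next n (p n) end).
  assert (Hstep : forall n,
    (fst (p n) <= fst (p (S n)) <= fst (p n) + dx (S n)) /\
    (snd (p n) <= snd (p (S n)) <= snd (p n) + dt (S n))).
  { intros n. simpl p. destruct (p n) as [x t]. simpl.
    specialize (Hdx0 (S n)). specialize (Hdt0 (S n)).
    repeat destruct Rle_dec; simpl; lra. }
  destruct (nested_intervals (fun n => fst (p n)) (B - A)) as [x Hx];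
    [lra|intros n; apply Hstep|].
  destruct (nested_intervals (fun n => snd (p n)) (b - a)) as [t Ht];
    [lra|intros n; apply Hstep|].
  assert (Hin : forall n, A <= fst (p n) /\ fst (p n) + dx n <= B).
  { induction n as [|n IH].
    - simpl. unfold dx. simpl. lra.
    - specialize (Hstep n). specialize (HdxS n). lra. }
  assert (Hbig : forall n, big n (fst (p n)) (snd (p n))).
  { induction n as [|n IH].
    - unfold big, dx, dt. simpl. unfold q.
      replace (A + (B - A) / 1) with B by field.
      replace (a + (b - a) / 1) with b by field. lra.
    - specialize (Hin n). specialize (HdxS n). specialize (HdtS n).
      specialize (Hdx0 (S n)). specialize (Hdt0 (S n)).
      unfold big in IH |- *. simpl p. destruct (p n) as [u v]. simpl in IH, Hin.
      rewrite (bd_split F A B u (u + dx n) v (v + dt n) (u + dx (S n)) (v + dt (S n))) in IH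
        by (auto; lra).
      replace (u + dx n) with (u + dx (S n) + dx (S n)) in IH by lra.
      replace (v + dt n) with (v + dt (S n) + dt (S n)) in IH by lra.
      replace (q / 4 ^ n) with (4 * (q / 4 ^ S n)) in IH
        by (simpl; field; apply pow_nonzero; lra).
      unfold next. repeat destruct Rle_dec; cbn [fst snd]; auto.
      apply Rnot_le_lt in n0, n1, n2.
      match type of IH with _ <= Rabs (?a + ?b + ?c + ?d) =>
        pose proof (Rabs_triang (a + b + c) d);
        pose proof (Rabs_triang (a + b) c);
        pose proof (Rabs_triang a b) end.
      lra. }
  assert (Hx0 : A <= x <= B).
  { specialize (Hx 0%nat). specialize (Hin 0%nat). unfold dx in Hin. lra. }
  destruct (cdiff_affine_approx F (pt x t)) as [l Hl].
  { apply HF. rewrite Cmod_pt; lra. }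
  (* [K / 2 ^ n] bounds the diameter of the n-th rectangle, [K' / 2 ^ n] half of its boundary
     length. *)
  set (K := (B - A) + 2 * B * (b - a)).
  set (K' := (b - a) + (B - A) / A).
  assert (HK : 0 <= K) by (unfold K; nra).
  assert (HK' : 0 <= K').
  { unfold K'. assert (0 <= (B - A) / A) by (apply Rdiv_le_0_compat; lra). lra. }
  destruct (Req_dec q 0) as [Hq|Hq].
  { unfold q in Hq. destruct (Req_dec (bd F A B a b) 0) as [|Hn]; auto.
    now apply Rabs_no_R0 in Hn. }
  exfalso.
  assert (Hq0 : 0 < q).
  { pose proof (Rabs_pos (bd F A B a b)). fold q in H. lra. }
  assert (HKK : 0 < 2 * K * K' + 1) by nra.
  (* The [+ 1] makes [eps * (2 K K') < q] strict and covers degenerate rectangles, where [K] or [K']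
     may vanish. *)
  set (eps := q / (2 * K * K' + 1)).
  assert (Heps : 0 < eps) by (apply Rdiv_lt_0_compat; auto).
  destruct (Hl eps Heps) as [d [Hd0 Hd]].
  destruct (exists_pow_half_lt K d Hd0) as [n Hn].
  specialize (Hbig n). specialize (Hx n). specialize (Ht n).
  specialize (Hin n). specialize (Hdx0 n). specialize (Hdt0 n). simpl in Hx, Ht.
  fold (dx n) in Hx. fold (dt n) in Ht.
  unfold big in Hbig. destruct (p n) as [u v]. simpl in Hbig, Hx, Ht, Hin.
  set (G := (fun w => F (pt x t) + l * (w - pt x t))%C).
  assert (HG : ann_cont G A B).
  { intros y s _. unfold G. apply ccont_plus; [apply ccont_const|].
    apply ccont_mult; [apply ccont_const|].
    apply ccont_plus; [apply ccont_id|apply ccont_const]. }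
  (* The affine approximation [G] integrates to 0, so [F] may be replaced by [F - G]. *)
  assert (HE : Rabs (bd F u (u + dx n) v (v + dt n)) <= 2 * (eps * (K / 2 ^ n)) * (dt n + dx n / A)).
  { replace (bd F u (u + dx n) v (v + dt n))
      with (bd (fun w => F w - G w)%C u (u + dx n) v (v + dt n)).
    - replace (dt n) with (v + dt n - v) at 2 by ring.
      replace (dx n) with (u + dx n - u) at 2 by ring.
      apply bd_bound with B; try lra.
      + intros y s Hy. apply ccont_ext_loc with (fun w => F w + - (1) * G w)%C 1;
          [lra|intros; ring|].
        apply ccont_plus; [auto|]. apply ccont_mult; [apply ccont_const|auto].
      + intros y s Hy Hs.
        assert (Hys : Cmod (pt y s - pt x t) <= K / 2 ^ n).
        { eapply Rle_trans; [apply pt_lipschitz|].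
          replace (K / 2 ^ n) with (dx n + 2 * B * dt n)
            by (unfold K, dx, dt; field; apply pow_nonzero; lra).
          rewrite (Rabs_pos_eq x) by lra.
          apply Rplus_le_compat; [apply Rabs_le; lra|].
          apply Rmult_le_compat; try lra; try apply Rabs_pos.
          apply Rabs_le; lra. }
        eapply Rle_trans; [apply Hd; lra|].
        apply Rmult_le_compat_l; lra.
    - rewrite (bd_minus F G A B) by (auto; lra).
      replace (bd G u (u + dx n) v (v + dt n)) with 0; [ring|].
      transitivity (bd (fun w => (F (pt x t) - l * pt x t) + l * w)%C u (u + dx n) v (v + dt n)).
      + symmetry; apply bd_affine; lra.
      + assert (E : forall w, ((F (pt x t) - l * pt x t) + l * w)%C = G w)
          by (intros; unfold G; ring).
        unfold bd. f_equal; f_equal; apply RInt_ext; intros; now rewrite E. }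
  assert (H4 : 4 ^ n = 2 ^ n * 2 ^ n) by (rewrite <- Rpow_mult_distr; f_equal; lra).
  specialize (Hp n).
  replace (2 * (eps * (K / 2 ^ n)) * (dt n + dx n / A)) with (eps * (2 * K * K') / 4 ^ n) in HE
    by (rewrite H4; unfold K', dx, dt; field; lra).
  assert (Hlt : eps * (2 * K * K') < q).
  { replace q with (eps * (2 * K * K' + 1)) by (unfold eps; field; lra). nra. }
  assert (H4p : 0 < / 4 ^ n) by (apply Rinv_0_lt_compat, pow_lt; lra).
  unfold Rdiv in *. nra.
Qed.

(** * Circular means *)

Definition rmean (h : R -> R) : R := RInt h 0 (2 * PI) / (2 * PI).

Definition cmean (F : C -> C) (rho : R) : C :=
  (rmean (fun t => Re (F (pt rho t))), rmean (fun t => Im (F (pt rho t)))).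

Lemma two_PI_pos : 0 < 2 * PI.
Proof. pose proof PI_RGT_0. lra. Qed.

Lemma rmean_ext h k : (forall t, h t = k t) -> rmean h = rmean k.
Proof. intros H. unfold rmean. f_equal. apply RInt_ext. auto. Qed.

Lemma rmean_const c : rmean (fun _ => c) = c.
Proof.
  unfold rmean. rewrite RInt_const. unfold scal; simpl; unfold mult; simpl.
  field. apply PI_neq0.
Qed.

Lemma rmean_plus h k : ex_RInt h 0 (2 * PI) -> ex_RInt k 0 (2 * PI) ->
  rmean (fun t => h t + k t) = rmean h + rmean k.
Proof.
  intros Hh Hk. unfold rmean.
  rewrite (RInt_plus (V := R_CompleteNormedModule) h k) by auto.
  unfold plus; simpl. field. apply PI_neq0.
Qed.

Lemma rmean_scal c h : ex_RInt h 0 (2 * PI) -> rmean (fun t => c * h t) = c * rmean h.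
Proof.
  intros Hh. unfold rmean.
  rewrite (RInt_scal (V := R_CompleteNormedModule) h) by auto.
  unfold scal; simpl; unfold mult; simpl. field. apply PI_neq0.
Qed.

Lemma rmean_le h k : ex_RInt h 0 (2 * PI) -> ex_RInt k 0 (2 * PI) ->
  (forall t, 0 < t < 2 * PI -> h t <= k t) -> rmean h <= rmean k.
Proof.
  intros Hh Hk H. pose proof two_PI_pos. unfold rmean.
  apply Rmult_le_compat_r; [left; now apply Rinv_0_lt_compat|].
  apply RInt_le; auto; lra.
Qed.

Lemma ex_RInt_scal_R c h : ex_RInt h 0 (2 * PI) -> ex_RInt (fun t => c * h t) 0 (2 * PI).
Proof. intros H. apply (ex_RInt_scal (V := R_NormedModule)); auto. Qed.

Lemma ex_RInt_plus_R h k : ex_RInt h 0 (2 * PI) -> ex_RInt k 0 (2 * PI) ->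
  ex_RInt (fun t => h t + k t) 0 (2 * PI).
Proof. intros H K. apply (ex_RInt_plus (V := R_NormedModule)); auto. Qed.

Lemma ex_RInt_const_R (c : R) : ex_RInt (fun _ => c) 0 (2 * PI).
Proof. apply (ex_RInt_const (V := R_NormedModule)). Qed.

Lemma cmean_ext F G rho : (forall t, F (pt rho t) = G (pt rho t)) ->
  cmean F rho = cmean G rho.
Proof.
  intros H. unfold cmean. f_equal; apply rmean_ext; intros; now rewrite H.
Qed.

Lemma cmean_const c rho : cmean (fun _ => c) rho = c.
Proof. unfold cmean. rewrite !rmean_const. now destruct c. Qed.

Lemma cmean_plus F G rho : circ_cont F rho -> circ_cont G rho ->
  cmean (fun w => F w + G w)%C rho = (cmean F rho + cmean G rho)%C.
Proof.
  intros HF HG. unfold cmean.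
  apply injective_projections; simpl; rewrite <- rmean_plus;
    auto using ex_RInt_circ_Re, ex_RInt_circ_Im.
Qed.

Lemma cmean_scal c F rho : circ_cont F rho ->
  cmean (fun w => c * F w)%C rho = (c * cmean F rho)%C.
Proof.
  intros HF. destruct c as [x y].
  pose proof (ex_RInt_circ_Re F rho 0 (2 * PI) HF) as HR.
  pose proof (ex_RInt_circ_Im F rho 0 (2 * PI) HF) as HI.
  unfold cmean. apply injective_projections; simpl.
  - transitivity (x * rmean (fun t => Re (F (pt rho t)))
      + - y * rmean (fun t => Im (F (pt rho t)))); [|ring].
    rewrite <- !rmean_scal, <- rmean_plus by auto using ex_RInt_scal_R.
    apply rmean_ext. intros; unfold Re, Im; ring.
  - rewrite <- !rmean_scal, <- rmean_plus by auto using ex_RInt_scal_R.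
    apply rmean_ext. intros; unfold Re, Im; ring.
Qed.

(** Pairing with the conjugate of the mean [m] reduces to a real integral: [|m|^2] is the mean of
    [Re (conj m F)], hence at most [|m| M]. Bounding the components separately would lose a
    factor. *)
Lemma cmean_bound F rho M : circ_cont F rho ->
  (forall t, Cmod (F (pt rho t)) <= M) -> Cmod (cmean F rho) <= M.
Proof.
  intros HF HM. set (m := cmean F rho).
  assert (HM0 : 0 <= M) by (eapply Rle_trans; [apply Cmod_ge_0|apply (HM 0)]).
  assert (H : Cmod m * Cmod m <= Cmod m * M).
  { replace (Cmod m * Cmod m) with (Re (Cconj m * m)%C).
    2:{ pose proof (Cmod2_conj m) as H.
        apply (f_equal Re) in H.
        rewrite Cmult_comm, <- H. simpl. ring. }
    unfold m at 2. rewrite <- cmean_scal by auto.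
    unfold cmean at 1. simpl.
    replace (Cmod m * M) with (rmean (fun _ => Cmod m * M)) by apply rmean_const.
    apply rmean_le.
    - apply (ex_RInt_circ_Re (fun w => Cconj m * F w)%C).
      intros t. apply ccont_mult; [apply ccont_const|apply HF].
    - apply ex_RInt_const_R.
    - intros t _. eapply Rle_trans; [apply Rle_abs|].
      eapply Rle_trans; [apply (re_le_Cmod (Cconj m * F (pt rho t))%C)|].
      rewrite Cmod_mult, Cmod_conj. apply Rmult_le_compat_l; [apply Cmod_ge_0|apply HM]. }
  pose proof (Cmod_ge_0 m). destruct (Req_dec (Cmod m) 0) as [->|Hm]; auto.
  apply Rmult_le_reg_l with (Cmod m); auto. lra.
Qed.

Lemma cmean_annulus F A B : 0 < A <= B -> ann_diff F A B -> cmean F A = cmean F B.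
Proof.
  intros HA HF. pose proof two_PI_pos.
  assert (K : forall G, ann_diff G A B ->
    rmean (fun t => Re (G (pt A t))) = rmean (fun t => Re (G (pt B t)))).
  { intros G HG. pose proof (goursat G A B 0 (2 * PI) HA ltac:(lra) HG) as HQ.
    unfold bd in HQ.
    assert (E : RInt (fun x => Im (G (pt x (2 * PI))) / x) A B =
      RInt (fun x => Im (G (pt x 0)) / x) A B).
    { apply RInt_ext. intros x _. unfold pt.
      now rewrite cos_2PI, sin_2PI, cos_0, sin_0. }
    unfold rmean. f_equal. lra. }
  unfold cmean. f_equal; [now apply K|].
  (* [goursat] only controls real parts; the imaginary part of [F] is the real part of [- i F]. *)
  pose proof (K (fun w => - Ci * F w)%C) as KI.
  assert (HG : ann_diff (fun w => - Ci * F w)%C A B).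
  { intros z Hz. apply cdiff_mult; [apply cdiff_const|now apply HF]. }
  specialize (KI HG).
  assert (E : forall z, Im z = Re (- Ci * z)%C) by (intros; simpl; unfold Im; ring).
  rewrite (rmean_ext (fun t => Im (F (pt A t))) _ (fun t => E _)).
  rewrite (rmean_ext (fun t => Im (F (pt B t))) _ (fun t => E _)).
  exact KI.
Qed.

Lemma rmean_close h k eps : ex_RInt h 0 (2 * PI) -> ex_RInt k 0 (2 * PI) ->
  (forall t, 0 <= t <= 2 * PI -> Rabs (h t - k t) <= eps) ->
  Rabs (rmean h - rmean k) <= eps.
Proof.
  intros Hh Hk H.
  assert (K : forall h k, ex_RInt h 0 (2 * PI) -> ex_RInt k 0 (2 * PI) ->
    (forall t, 0 <= t <= 2 * PI -> Rabs (h t - k t) <= eps) -> rmean h <= rmean k + eps).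
  { clear. intros h k Hh Hk H. rewrite <- (rmean_const eps), <- rmean_plus
      by auto using ex_RInt_const_R.
    apply rmean_le; auto using ex_RInt_const_R, ex_RInt_plus_R.
    intros t Ht. specialize (H t ltac:(lra)). apply Rabs_le_between in H. lra. }
  apply Rabs_le. pose proof (K h k Hh Hk H).
  assert (rmean k <= rmean h + eps); [|lra].
  apply K; auto. intros. rewrite Rabs_minus_sym. auto.
Qed.

(** This allows crossing the circle [|w| = |z|], where a difference quotient at [z] is only known to
    be continuous. *)
Lemma cmean_continuous F rho eps : circ_cont F rho -> 0 < eps ->
  exists delta, 0 < delta /\ forall s, Rabs (s - rho) < delta -> circ_cont F s ->
    Cmod (cmean F s - cmean F rho) <= eps.
Proof.
  intros HF Heps.
  assert (He : 0 < eps / 2) by lra.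
  assert (K : forall f : C -> R,
    (forall t, continuity_2d_pt (fun x y => f (pt x y)) rho t) ->
    exists delta, 0 < delta /\ forall s t, Rabs (s - rho) < delta -> 0 <= t <= 2 * PI ->
     Rabs (f (pt s t) - f (pt rho t)) <= eps / 2).
  { intros f Hf.
    destruct (uniform_continuity_2d_1d' (fun x y => f (pt x y)) 0 (2 * PI) rho
      (fun t _ => Hf t) (mkposreal _ He)) as [d Hd].
    exists d; split; [apply cond_pos|]. intros s t Hs Ht.
    pose proof (cond_pos d). apply Rabs_def2 in Hs.
    left. apply (Hd t rho t s); try lra.
    rewrite Rminus_eq_0, Rabs_R0. auto. }
  destruct (K (fun z => Re (F z))) as [d [Hd0 Hd]]; [intros t; apply (ccont_2d F rho t (HF t))|].
  destruct (K (fun z => Im (F z))) as [e [He0 Hf]]; [intros t; apply (ccont_2d F rho t (HF t))|].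
  exists (Rmin d e); split; [now apply Rmin_pos|]. intros s Hs HFs.
  pose proof (Rmin_l d e); pose proof (Rmin_r d e).
  eapply Rle_trans; [apply Cmod_le_Re_Im|].
  replace eps with (eps / 2 + eps / 2) by field.
  apply Rplus_le_compat; (apply rmean_close;
    [auto using ex_RInt_circ_Re, ex_RInt_circ_Im ..|]); intros t Ht.
  - apply Hd; lra.
  - apply Hf; lra.
Qed.

(** * Cauchy's formula *)

Lemma Cminus_neq_0 (w z : C) : w <> z -> (w - z)%C <> RtoC 0.
Proof.
  intros H E. apply H. replace w with (w - z + z)%C by ring. rewrite E. ring.
Qed.

Lemma Cmod_neq (w z : C) : Cmod z < Cmod w -> w <> z.
Proof. intros H ->. lra. Qed.

Lemma Cmod_le_eps_0 (c : C) : (forall eps, 0 < eps -> Cmod c <= eps) -> c = RtoC 0.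
Proof.
  intros H. apply Cmod_eq_0. pose proof (Cmod_ge_0 c).
  destruct (Req_dec (Cmod c) 0) as [|Hc]; auto.
  specialize (H (Cmod c / 2) ltac:(lra)). lra.
Qed.

Lemma cdiff_shifted_inv z w : w <> z -> cdiff (fun v => / (v - z))%C w.
Proof.
  intros H. apply cdiff_inv; [now apply Cminus_neq_0|].
  apply cdiff_minus; [apply cdiff_id|apply cdiff_const].
Qed.

Lemma cdiff_circ_cont F rho : 0 <= rho ->
  (forall w, Cmod w = rho -> cdiff F w) -> circ_cont F rho.
Proof. intros Hr H t. apply cdiff_ccont, H, Cmod_pt, Hr. Qed.

Lemma kernel_bound (w z : C) : Cmod z < Cmod w ->
  Cmod (z / (w - z)) <= Cmod z / (Cmod w - Cmod z).
Proof.
  intros H. rewrite Cmod_div by now apply Cminus_neq_0, Cmod_neq.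
  pose proof (Cmod_reverse_triangle w z).
  apply Rmult_le_compat_l; [apply Cmod_ge_0|].
  apply Rinv_le_contravar; lra.
Qed.

Lemma kernel_cdiff (w z : C) : Cmod z < Cmod w -> cdiff (fun v => z / (v - z))%C w.
Proof.
  intros H. apply cdiff_mult; [apply cdiff_const|].
  now apply cdiff_shifted_inv, Cmod_neq.
Qed.

(** The kernel is holomorphic for [|w| > |z|], so its mean can be moved to arbitrarily large
    circles, where it tends to 0. *)
Lemma cmean_kernel z rho : Cmod z < rho -> cmean (fun w => z / (w - z))%C rho = RtoC 0.
Proof.
  intros Hz. pose proof (Cmod_ge_0 z) as Hz0.
  assert (K : forall s, rho <= s ->
    Cmod (cmean (fun w => z / (w - z))%C rho) <= Cmod z / (s - Cmod z)).
  { intros s Hs. rewrite (cmean_annulus _ rho s); [|lra|].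
    - apply cmean_bound.
      + apply cdiff_circ_cont; [lra|]. intros w Hw. apply kernel_cdiff. lra.
      + intros t. rewrite <- (Cmod_pt s t) at 2 by lra. apply kernel_bound.
        rewrite Cmod_pt; lra.
    - intros w Hw. apply kernel_cdiff. lra. }
  apply Cmod_le_eps_0. intros eps Heps.
  assert (0 <= Cmod z / eps) by (apply Rdiv_le_0_compat; lra).
  eapply Rle_trans; [apply (K (rho + Cmod z / eps)); lra|].
  apply Rle_div_l; [lra|].
  replace (eps * (rho + Cmod z / eps - Cmod z)) with (Cmod z + eps * (rho - Cmod z))
    by (field; lra).
  nra.
Qed.

(* Holomorphic functions on the unit disc, up to their value at [0], which is irrelevant
   by Riemann's theorem. *)
Definition hol0 (F : C -> C) : Prop :=
  (forall z, 0 < Cmod z < 1 -> cdiff F z) /\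
  exists delta M, 0 < delta /\ forall z, 0 < Cmod z < delta -> Cmod (F z) <= M.

Lemma hol0_circ_cont F rho : hol0 F -> 0 < rho < 1 -> circ_cont F rho.
Proof.
  intros [HF _] Hr. apply cdiff_circ_cont; [lra|]. intros w Hw. apply HF. lra.
Qed.

(** Away from [0] and [z] the function is holomorphic, so its mean is constant for radii below [|z|]
    and again for radii above. It tends to 0 with the radius, thanks to the factor [w], and
    continuity at the radius [|z|] joins the two ranges. *)
Lemma cmean_difference_quotient F z rho : hol0 F -> 0 < Cmod z < rho -> rho < 1 ->
  cmean (fun w => w * ((F w - F z) / (w - z)))%C rho = RtoC 0.
Proof.
  intros [HF [d0 [M [Hd0 HM]]]] Hz Hrho.
  destruct (HF z ltac:(lra)) as [D [HD [d [Hd Hd1]]]].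
  (* Filling the point [z] with the slope [D z] makes [K] continuous there. *)
  set (K := fun w => (w * (if Ceq_dec w z then D z else (F w - F z) / (w - z)))%C).
  assert (KE : forall w, w <> z -> K w = (w * ((F w - F z) / (w - z)))%C).
  { intros w Hw. unfold K. now destruct (Ceq_dec w z). }
  rewrite <- (cmean_ext K).
  2:{ intros t. apply KE. apply Cmod_neq. rewrite Cmod_pt; lra. }
  assert (Kd : forall w, 0 < Cmod w < 1 -> w <> z -> cdiff K w).
  { intros w Hw Hwz.
    apply cdiff_ext_loc with (fun w => w * ((F w - F z) / (w - z)))%C (Cmod (w - z)).
    - now apply Cmod_gt_0, Cminus_neq_0.
    - intros v Hv. rewrite KE; auto. intros ->.
      rewrite Cmod_minus_sym in Hv. lra.
    - apply cdiff_mult; [apply cdiff_id|].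
      apply cdiff_mult; [|now apply cdiff_shifted_inv].
      apply cdiff_minus; [auto|apply cdiff_const]. }
  assert (Kc : forall w, 0 < Cmod w < 1 -> ccont K w).
  { intros w Hw. destruct (Ceq_dec w z) as [->|Hwz].
    - apply ccont_ext_loc with (fun w => w * D w)%C d; auto.
      + intros w Hwd. unfold K. destruct (Ceq_dec w z) as [->|Hwz]; auto.
        rewrite Hd1 by auto. field. now apply Cminus_neq_0.
      + apply ccont_mult; [apply ccont_id|auto].
    - now apply cdiff_ccont, Kd. }
  assert (Kcirc : forall s, 0 < s < 1 -> circ_cont K s).
  { intros s Hs t. apply Kc. rewrite Cmod_pt; lra. }
  assert (Hin : forall s, 0 < s < Cmod z -> cmean K s = RtoC 0).
  { intros s Hs. apply Cmod_le_eps_0. intros eps Heps.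
    set (L := (Rabs M + Cmod (F z)) / (Cmod z / 2)).
    pose proof (Rabs_pos M). pose proof (Cmod_ge_0 (F z)).
    assert (HL : 0 <= L) by (apply Rdiv_le_0_compat; lra).
    (* The radius [u] stays below [s], in the zone where [F] is bounded, far from [z], and is small
       enough that [u L <= eps]. *)
    set (u := Rmin s (Rmin (d0 / 2) (Rmin (Cmod z / 2) (eps / (L + 1))))).
    assert (Hu : 0 < u).
    { unfold u. repeat apply Rmin_pos; try lra. apply Rdiv_lt_0_compat; lra. }
    assert (Hus : u <= s) by apply Rmin_l.
    assert (Hu1 : u <= d0 / 2) by (eapply Rle_trans; [apply Rmin_r|apply Rmin_l]).
    assert (Hu2 : u <= Cmod z / 2).
    { do 2 (eapply Rle_trans; [apply Rmin_r|]). apply Rmin_l. }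
    assert (Hu3 : u <= eps / (L + 1)).
    { do 2 (eapply Rle_trans; [apply Rmin_r|]). apply Rmin_r. }
    rewrite <- (cmean_annulus K u s); [|lra|].
    2:{ intros w Hw. apply Kd; [lra|]. intros ->. lra. }
    apply cmean_bound; [apply Kcirc; lra|].
    intros t. set (w := pt u t).
    assert (Hw : Cmod w = u) by (apply Cmod_pt; lra).
    assert (Hwz : w <> z) by (intros E; rewrite E in Hw; lra).
    rewrite KE by auto. rewrite Cmod_mult, Cmod_div, Hw by now apply Cminus_neq_0.
    assert (H3 : Cmod (F w - F z) <= Rabs M + Cmod (F z)).
    { eapply Rle_trans; [apply Cmod_triangle_minus|].
      pose proof (Rle_abs M). specialize (HM w ltac:(lra)). lra. }
    assert (H4 : Cmod z / 2 <= Cmod (w - z)).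
    { rewrite Cmod_minus_sym. pose proof (Cmod_reverse_triangle z w). lra. }
    assert (H5 : Cmod (F w - F z) / Cmod (w - z) <= L).
    { apply Rmult_le_compat; auto; [apply Cmod_ge_0| |].
      - left; apply Rinv_0_lt_compat; lra.
      - apply Rinv_le_contravar; lra. }
    apply Rle_trans with (eps / (L + 1) * L).
    - apply Rmult_le_compat; try lra.
      apply Rdiv_le_0_compat; [apply Cmod_ge_0|lra].
    - replace eps with (eps / (L + 1) * (L + 1)) at 2 by (field; lra).
      apply Rmult_le_compat_l; [|lra]. left; apply Rdiv_lt_0_compat; lra. }
  apply Cmod_le_eps_0. intros eps Heps.
  destruct (cmean_continuous K (Cmod z) (eps / 2)) as [e [He Hc]];
    [apply Kcirc; lra|lra|].
  (* Two radii on either side of [|z|], each within [e] of it. *)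
  set (s1 := Rmax (Cmod z / 2) (Cmod z - e / 2)).
  set (s2 := Rmin rho (Cmod z + e / 2)).
  assert (Hs1 : Cmod z / 2 <= s1 /\ Cmod z - e / 2 <= s1 /\ s1 < Cmod z).
  { unfold s1. split; [apply Rmax_l|]. split; [apply Rmax_r|]. apply Rmax_lub_lt; lra. }
  assert (Hs2 : s2 <= rho /\ s2 <= Cmod z + e / 2 /\ Cmod z < s2).
  { unfold s2. split; [apply Rmin_l|]. split; [apply Rmin_r|]. apply Rmin_glb_lt; lra. }
  rewrite <- (cmean_annulus K s2 rho); [|lra|].
  2:{ intros w Hw. apply Kd; [lra|]. intros ->. lra. }
  pose proof (Hc s1 ltac:(apply Rabs_def1; lra) (Kcirc s1 ltac:(lra))) as H1.
  pose proof (Hc s2 ltac:(apply Rabs_def1; lra) (Kcirc s2 ltac:(lra))) as H2.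
  rewrite (Hin s1) in H1 by lra. rewrite Cmod_minus_sym, Cmod_minus_0 in H1.
  pose proof (Cmod_reverse_triangle (cmean K s2) (cmean K (Cmod z))). lra.
Qed.

(** For the measure [dw / (i w)] the Cauchy kernel is [w / (w - z) = 1 + z / (w - z)]. Its constant
    part is kept apart so that the distance from [F z] to the mean is visibly of order [|z|]. *)
Lemma cauchy_formula F z rho : hol0 F -> 0 < Cmod z < rho -> rho < 1 ->
  F z = (cmean F rho + cmean (fun w => F w * (z / (w - z))) rho)%C.
Proof.
  intros HF Hz Hrho.
  pose proof (cmean_difference_quotient F z rho HF Hz Hrho) as H.
  pose proof (cmean_kernel z rho ltac:(lra)) as Hk.
  assert (Fc : circ_cont F rho) by (apply hol0_circ_cont; auto; lra).
  assert (kc : circ_cont (fun w => z / (w - z))%C rho).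
  { apply cdiff_circ_cont; [lra|]. intros w Hw. apply kernel_cdiff. lra. }
  assert (Fkc : circ_cont (fun w => F w * (z / (w - z)))%C rho).
  { intros t. apply ccont_mult; [apply Fc|apply kc]. }
  rewrite (cmean_ext _ (fun w => (F w + F w * (z / (w - z)))
    + - F z * (1 + z / (w - z)))%C) in H.
  2:{ intros t. field. apply Cminus_neq_0, Cmod_neq. rewrite Cmod_pt; lra. }
  rewrite (cmean_plus (fun w => F w + F w * (z / (w - z)))%C) in H.
  2:{ intros t. apply ccont_plus; auto. }
  2:{ intros t. apply ccont_mult; [apply ccont_const|].
      apply ccont_plus; [apply ccont_const|apply kc]. }
  rewrite cmean_scal in H.
  2:{ intros t. apply ccont_plus; [apply ccont_const|apply kc]. }
  rewrite (cmean_plus F), (cmean_plus (fun _ => RtoC 1)), cmean_const, Hk in H; auto.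
  2:{ intros t. apply ccont_const. }
  match type of H with ?a = _ => transitivity (F z + a)%C; [rewrite H; ring|ring] end.
Qed.

Lemma cauchy_estimate F z rho M : hol0 F -> 0 < Cmod z < rho -> rho < 1 ->
  (forall t, Cmod (F (pt rho t)) <= M) ->
  Cmod (F z - cmean F rho) <= M * (Cmod z / (rho - Cmod z)).
Proof.
  intros HF Hz Hrho HM. rewrite (cauchy_formula F z rho) by auto.
  match goal with |- Cmod (?a + ?b - ?a) <= _ => replace (a + b - a)%C with b by ring end.
  apply cmean_bound.
  - intros t. apply ccont_mult; [now apply hol0_circ_cont; [|lra]|].
    apply cdiff_ccont, kernel_cdiff. rewrite Cmod_pt; lra.
  - intros t. rewrite Cmod_mult. apply Rmult_le_compat; try apply Cmod_ge_0; auto.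
    rewrite <- (Cmod_pt rho t) at 2 by lra. apply kernel_bound. rewrite Cmod_pt; lra.
Qed.

(** The value at 0 of the holomorphic extension of [F]; the radius is arbitrary, by [cmean_c0]. *)
Definition c0 (F : C -> C) : C := cmean F (1 / 2).

Definition Sh (F : C -> C) : C -> C := fun z => ((F z - c0 F) / z)%C.

Lemma cmean_c0 F rho : hol0 F -> 0 < rho < 1 -> cmean F rho = c0 F.
Proof.
  intros [HF _] Hr. unfold c0. destruct (Rle_dec rho (1 / 2)).
  - apply cmean_annulus; [lra|]. intros z Hz. apply HF. lra.
  - symmetry. apply cmean_annulus; [lra|]. intros z Hz. apply HF. lra.
Qed.

(** Riemann's removable singularity theorem in quantitative form: the linear bound is what keeps the
    shift [Sh F] bounded near 0. *)
Lemma c0_approx F : hol0 F -> exists delta M, 0 < delta /\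
  forall z, 0 < Cmod z < delta -> Cmod (F z - c0 F) <= M * Cmod z.
Proof.
  intros HF. pose proof HF as [_ [d [M [Hd HM]]]].
  set (rho := Rmin (d / 2) (1 / 2)).
  assert (Hr : 0 < rho) by (apply Rmin_pos; lra).
  assert (Hr1 : rho <= d / 2) by apply Rmin_l.
  assert (Hr2 : rho <= 1 / 2) by apply Rmin_r.
  exists (rho / 2), (M * (2 / rho)). split; [lra|]. intros z Hz.
  rewrite <- (cmean_c0 F rho) by (auto; lra).
  eapply Rle_trans; [apply cauchy_estimate with (rho := rho) (M := M); auto; try lra|].
  - intros t. apply HM. rewrite Cmod_pt; lra.
  - assert (0 <= M). { eapply Rle_trans; [apply Cmod_ge_0|]. apply (HM z). lra. }
    rewrite Rmult_assoc. apply Rmult_le_compat_l; auto.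
    rewrite (Rmult_comm (2 / rho)). apply Rmult_le_compat_l; [lra|].
    replace (2 / rho) with (/ (rho / 2)) by (field; lra).
    apply Rinv_le_contravar; lra.
Qed.

Lemma hol0_Sh F : hol0 F -> hol0 (Sh F).
Proof.
  intros HF. split.
  - intros z Hz. apply cdiff_div; [now apply Cmod_neq_0| |apply cdiff_id].
    apply cdiff_minus; [now apply HF|apply cdiff_const].
  - destruct (c0_approx F HF) as [d [M [Hd HM]]]. exists d, M. split; auto.
    intros z Hz. unfold Sh. rewrite Cmod_div by now apply Cmod_neq_0.
    apply Rle_div_l; [lra|auto].
Qed.

Lemma Sh_eq F z : z <> RtoC 0 -> F z = (c0 F + z * Sh F z)%C.
Proof. intros Hz. unfold Sh. field. auto. Qed.

Definition lim0 (F : C -> C) (c : C) : Prop :=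
  forall eps, 0 < eps -> exists delta, 0 < delta /\
    forall z, 0 < Cmod z < delta -> Cmod (F z - c) <= eps.

Lemma hol0_lim0 F : hol0 F -> lim0 F (c0 F).
Proof.
  intros HF eps Heps. destruct (c0_approx F HF) as [d [M [Hd HM]]].
  pose proof (Rabs_pos M).
  exists (Rmin d (eps / (Rabs M + 1))). split.
  - apply Rmin_pos; auto. apply Rdiv_lt_0_compat; lra.
  - intros z Hz. pose proof (Rmin_l d (eps / (Rabs M + 1))).
    pose proof (Rmin_r d (eps / (Rabs M + 1))).
    eapply Rle_trans; [apply HM; lra|].
    apply Rle_trans with (Rabs M * (eps / (Rabs M + 1))).
    + pose proof (Rle_abs M). apply Rle_trans with (Rabs M * Cmod z); [nra|].
      apply Rmult_le_compat_l; lra.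
    + apply Rle_trans with ((Rabs M + 1) * (eps / (Rabs M + 1))); [|right; field; lra].
      apply Rmult_le_compat_r; [|lra]. left; apply Rdiv_lt_0_compat; lra.
Qed.

Lemma lim0_unique F c d : lim0 F c -> lim0 F d -> c = d.
Proof.
  intros Hc Hd. assert (E : (c - d)%C = RtoC 0).
  { apply Cmod_le_eps_0. intros eps Heps.
    destruct (Hc (eps / 2)) as [d1 [Hd1 H1]]; [lra|].
    destruct (Hd (eps / 2)) as [d2 [Hd2 H2]]; [lra|].
    set (u := Rmin d1 d2 / 2).
    assert (0 < Rmin d1 d2) by now apply Rmin_pos.
    pose proof (Rmin_l d1 d2). pose proof (Rmin_r d1 d2).
    assert (Hu : Cmod u = u) by (rewrite Cmod_R; apply Rabs_pos_eq; unfold u; lra).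
    specialize (H1 u ltac:(rewrite Hu; unfold u; lra)).
    specialize (H2 u ltac:(rewrite Hu; unfold u; lra)).
    replace (c - d)%C with ((F u - d) - (F u - c))%C by ring.
    pose proof (Cmod_triangle_minus (F u - d) (F u - c)). lra. }
  replace c with ((c - d) + d)%C by ring. rewrite E. ring.
Qed.

Lemma hol0_pow F n : hol0 F -> hol0 (fun z => Cpow (F z) n).
Proof.
  intros [HF [d [M [Hd HM]]]]. split.
  - intros z Hz. now apply cdiff_pow, HF.
  - exists d, (M ^ n). split; auto. intros z Hz. rewrite Cmod_pow.
    apply pow_incr. split; [apply Cmod_ge_0|auto].
Qed.

(* Cauchy's estimate for [F ^ n] loses a constant factor whose n-th root tends to 1. *)
Lemma max_modulus F z rho M : hol0 F -> 0 < Cmod z < rho -> rho < 1 ->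
  (forall t, Cmod (F (pt rho t)) <= M) -> Cmod (F z) <= M.
Proof.
  intros HF Hz Hrho HM.
  set (K := 1 + Cmod z / (rho - Cmod z)).
  assert (HM0 : 0 <= M) by (eapply Rle_trans; [apply Cmod_ge_0|apply (HM 0)]).
  assert (H : forall n, Cmod (F z) ^ n <= M ^ n * K).
  { intros n. pose proof (hol0_pow F n HF) as HFn.
    assert (HMn : forall t, Cmod (Cpow (F (pt rho t)) n) <= M ^ n).
    { intros t. rewrite Cmod_pow. apply pow_incr. split; [apply Cmod_ge_0|auto]. }
    pose proof (cauchy_estimate _ z rho _ HFn Hz Hrho HMn) as H1.
    pose proof (cmean_bound _ rho _ (hol0_circ_cont _ rho HFn ltac:(lra)) HMn) as H2.
    simpl in H1. rewrite <- Cmod_pow.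
    pose proof (Cmod_reverse_triangle (Cpow (F z) n) (cmean (fun z => Cpow (F z) n) rho)).
    unfold K. lra. }
  destruct (Rle_dec (Cmod (F z)) M) as [|Hlt]; auto. exfalso.
  apply Rnot_le_lt in Hlt.
  destruct (Req_dec M 0) as [HMz|HMz].
  { specialize (H 1%nat). simpl in H. nra. }
  (* If [|F z| > M], the powers of this ratio outgrow the constant [K]. *)
  set (q := Cmod (F z) / M).
  assert (Hq : 1 < q) by (apply Rlt_div_r; lra).
  destruct (Pow_x_infinity q ltac:(rewrite Rabs_pos_eq; lra) (K + 1)) as [N HN].
  specialize (HN N (Nat.le_refl N)). specialize (H N).
  rewrite Rabs_pos_eq in HN by (apply pow_le; lra).
  replace (Cmod (F z)) with (M * q) in H by (unfold q; field; lra).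
  rewrite Rpow_mult_distr in H.
  assert (0 < M ^ N) by (apply pow_lt; lra).
  apply Rmult_le_reg_l in H; auto. lra.
Qed.

(** The maximum principle on the circle of radius [rho] gives the bound [1 / rho]; then [rho] tends
    to 1. *)
Lemma schwarz F : hol0 F -> (forall z, 0 < Cmod z < 1 -> Cmod (z * F z) <= 1) ->
  forall z, 0 < Cmod z < 1 -> Cmod (F z) <= 1.
Proof.
  intros HF H z Hz.
  assert (K : forall rho, Cmod z < rho < 1 -> Cmod (F z) <= / rho).
  { intros rho Hr. apply max_modulus with rho; auto; try lra.
    intros t. specialize (H (pt rho t)). rewrite Cmod_mult, Cmod_pt in H by lra.
    apply Rmult_le_reg_l with rho; [lra|]. rewrite Rinv_r by lra. apply H. lra. }
  destruct (Rle_dec (Cmod (F z)) 1) as [|Hlt]; auto. exfalso.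
  apply Rnot_le_lt in Hlt. set (m := Cmod (F z)) in *.
  assert (Hm : / m < 1) by (rewrite <- Rinv_1; apply Rinv_lt_contravar; lra).
  (* Halfway between 1 and the larger of [|z|] and [1 / m], so that [|z| < rho < 1] and
     [1 / rho < m]. *)
  set (rho := (1 + Rmax (Cmod z) (/ m)) / 2).
  pose proof (Rmax_l (Cmod z) (/ m)). pose proof (Rmax_r (Cmod z) (/ m)).
  assert (Rmax (Cmod z) (/ m) < 1) by (apply Rmax_lub_lt; lra).
  assert (0 < / m) by (apply Rinv_0_lt_compat; lra).
  specialize (K rho ltac:(unfold rho; lra)).
  assert (/ rho < / / m) by (apply Rinv_lt_contravar; unfold rho; nra).
  rewrite Rinv_inv in *. lra.
Qed.

(** * Majorant sums *)

Definition eq0 (F G : C -> C) : Prop := forall z, 0 < Cmod z < 1 -> F z = G z.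

Lemma hol0_const c : hol0 (fun _ => c).
Proof.
  split; [intros; apply cdiff_const|]. exists 1, (Cmod c). split; intros; lra.
Qed.

Lemma hol0_id : hol0 (fun z => z).
Proof.
  split; [intros; apply cdiff_id|]. exists 1, 1. split; intros; lra.
Qed.

Lemma hol0_plus F G : hol0 F -> hol0 G -> hol0 (fun z => F z + G z)%C.
Proof.
  intros [HF [d [M [Hd HM]]]] [HG [e [L [He HL]]]]. split.
  - intros z Hz. apply cdiff_plus; auto.
  - exists (Rmin d e), (M + L). split; [now apply Rmin_pos|]. intros z Hz.
    pose proof (Rmin_l d e). pose proof (Rmin_r d e).
    eapply Rle_trans; [apply Cmod_triangle|].
    apply Rplus_le_compat; [apply HM|apply HL]; lra.
Qed.

Lemma hol0_mult F G : hol0 F -> hol0 G -> hol0 (fun z => F z * G z)%C.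
Proof.
  intros [HF [d [M [Hd HM]]]] [HG [e [L [He HL]]]]. split.
  - intros z Hz. apply cdiff_mult; auto.
  - exists (Rmin d e), (M * L). split; [now apply Rmin_pos|]. intros z Hz.
    pose proof (Rmin_l d e). pose proof (Rmin_r d e).
    rewrite Cmod_mult.
    apply Rmult_le_compat; try apply Cmod_ge_0; [apply HM|apply HL]; lra.
Qed.

Lemma hol0_scal c F : hol0 F -> hol0 (fun z => c * F z)%C.
Proof. apply hol0_mult, hol0_const. Qed.

Lemma c0_ext F G : eq0 F G -> c0 F = c0 G.
Proof. intros E. unfold c0. apply cmean_ext. intros t. apply E. rewrite Cmod_pt; lra. Qed.

Lemma Sh_ext F G : eq0 F G -> eq0 (Sh F) (Sh G).
Proof. intros E z Hz. unfold Sh. now rewrite (c0_ext F G), E. Qed.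

Lemma c0_const c : c0 (fun _ => c) = c.
Proof. unfold c0. apply cmean_const. Qed.

Lemma c0_plus F G : hol0 F -> hol0 G -> c0 (fun z => F z + G z)%C = (c0 F + c0 G)%C.
Proof. intros HF HG. unfold c0. apply cmean_plus; apply hol0_circ_cont; auto; lra. Qed.

Lemma lim0_mult F G c d : lim0 F c -> lim0 G d -> lim0 (fun z => F z * G z)%C (c * d)%C.
Proof.
  intros HF HG eps Heps.
  pose proof (Cmod_ge_0 c). pose proof (Cmod_ge_0 d).
  destruct (HF (eps / (2 * (Cmod d + 1)))) as [d1 [Hd1 H1]]; [apply Rdiv_lt_0_compat; lra|].
  destruct (HG (eps / (2 * (Cmod c + 1)))) as [d2 [Hd2 H2]]; [apply Rdiv_lt_0_compat; lra|].
  destruct (HG 1) as [d3 [Hd3 H3]]; [lra|].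
  exists (Rmin d1 (Rmin d2 d3)). split; [now repeat apply Rmin_pos|]. intros z Hz.
  pose proof (Rmin_l d1 (Rmin d2 d3)). pose proof (Rmin_r d1 (Rmin d2 d3)).
  pose proof (Rmin_l d2 d3). pose proof (Rmin_r d2 d3).
  specialize (H1 z ltac:(lra)). specialize (H2 z ltac:(lra)). specialize (H3 z ltac:(lra)).
  replace (F z * G z - c * d)%C with ((F z - c) * G z + c * (G z - d))%C by ring.
  eapply Rle_trans; [apply Cmod_triangle|]. rewrite !Cmod_mult.
  pose proof (Cmod_reverse_triangle (G z) d).
  replace eps with (eps / (2 * (Cmod d + 1)) * (Cmod d + 1)
    + (Cmod c + 1) * (eps / (2 * (Cmod c + 1)))) by (field; lra).
  apply Rplus_le_compat; apply Rmult_le_compat; try apply Cmod_ge_0; lra.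
Qed.

(** Circular means are not visibly multiplicative, but limits at 0 are. *)
Lemma c0_mult F G : hol0 F -> hol0 G -> c0 (fun z => F z * G z)%C = (c0 F * c0 G)%C.
Proof.
  intros HF HG. apply lim0_unique with (fun z => F z * G z)%C.
  - now apply hol0_lim0, hol0_mult.
  - apply lim0_mult; now apply hol0_lim0.
Qed.

Lemma c0_id : c0 (fun z => z) = RtoC 0.
Proof.
  apply lim0_unique with (fun z => z); [apply hol0_lim0, hol0_id|].
  intros eps Heps. exists eps; split; auto. intros z Hz. rewrite Cmod_minus_0. lra.
Qed.

Lemma c0_z_mult H : hol0 H -> c0 (fun z => z * H z)%C = RtoC 0.
Proof.
  intros HH. rewrite (c0_mult (fun z => z)) by auto using hol0_id. rewrite c0_id. ring.
Qed.

Lemma Sh_z_mult H : hol0 H -> eq0 (Sh (fun z => z * H z)%C) H.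
Proof.
  intros HH z Hz. unfold Sh. rewrite c0_z_mult by auto. field. now apply Cmod_neq_0.
Qed.

(* [maj r N F] is the majorant sum [|c_0| + |c_1| r + ... + |c_N| r^N] of the Taylor
   coefficients of [F], the coefficient [c_k] being read off as [c0] of the k-th shift. *)
Fixpoint maj (r : R) (N : nat) (F : C -> C) : R :=
  match N with
  | O => Cmod (c0 F)
  | S N => Cmod (c0 F) + r * maj r N (Sh F)
  end.

Lemma maj_ext r N : forall F G, eq0 F G -> maj r N F = maj r N G.
Proof.
  induction N as [|N IH]; intros F G E; simpl; rewrite (c0_ext F G E); auto.
  now rewrite (IH (Sh F) (Sh G)) by now apply Sh_ext.
Qed.

Lemma maj_ge_0 r N : 0 <= r -> forall F, 0 <= maj r N F.
Proof.
  intros Hr. induction N as [|N IH]; intros F; simpl; pose proof (Cmod_ge_0 (c0 F)); auto.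
  specialize (IH (Sh F)). nra.
Qed.

Lemma maj_le_S r N : 0 <= r -> forall F, maj r N F <= maj r (S N) F.
Proof.
  intros Hr. induction N as [|N IH]; intros F.
  - simpl. pose proof (Cmod_ge_0 (c0 (Sh F))). nra.
  - change (Cmod (c0 F) + r * maj r N (Sh F) <= Cmod (c0 F) + r * maj r (S N) (Sh F)).
    specialize (IH (Sh F)). nra.
Qed.

Lemma maj_plus r N : 0 <= r -> forall F G, hol0 F -> hol0 G ->
  maj r N (fun z => F z + G z)%C <= maj r N F + maj r N G.
Proof.
  intros Hr. induction N as [|N IH]; intros F G HF HG; simpl; rewrite c0_plus by auto;
    pose proof (Cmod_triangle (c0 F) (c0 G)); auto.
  rewrite (maj_ext r N _ (fun z => Sh F z + Sh G z)%C).
  - specialize (IH (Sh F) (Sh G) (hol0_Sh F HF) (hol0_Sh G HG)). nra.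
  - intros z Hz. unfold Sh. rewrite c0_plus by auto. field. now apply Cmod_neq_0.
Qed.

Lemma maj_scal r N c : forall F, hol0 F ->
  maj r N (fun z => c * F z)%C = Cmod c * maj r N F.
Proof.
  assert (Hc : forall F, hol0 F -> c0 (fun z => c * F z)%C = (c * c0 F)%C).
  { intros F HF. rewrite (c0_mult (fun _ => c)), c0_const by auto using hol0_const. auto. }
  induction N as [|N IH]; intros F HF; simpl; rewrite Hc, Cmod_mult by auto; auto.
  rewrite (maj_ext r N _ (fun z => c * Sh F z)%C).
  - rewrite IH by now apply hol0_Sh. ring.
  - intros z Hz. unfold Sh. rewrite Hc by auto. field. now apply Cmod_neq_0.
Qed.

(** The common step of the inductions for products and for quasi-subordination: a multiplication by
    [z] costs a factor [r] and one order. *)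
Lemma maj_scal_plus_z r N c F H : 0 <= r -> hol0 F -> hol0 H ->
  maj r (S N) (fun z => c * F z + z * H z)%C <= Cmod c * maj r (S N) F + r * maj r N H.
Proof.
  intros Hr HF HH.
  eapply Rle_trans; [apply maj_plus; auto using hol0_scal, hol0_mult, hol0_id|].
  rewrite maj_scal by auto. apply Rplus_le_compat_l.
  simpl. rewrite c0_z_mult, Cmod_0 by auto.
  rewrite (maj_ext r N _ H) by now apply Sh_z_mult. lra.
Qed.

(** Induction on [F G = c_0 G + z (Sh F) G]. The induction hypothesis sees [G] to order [N] only,
    hence the use of [maj_le_S]. *)
Lemma maj_mult r N : 0 <= r -> forall F G, hol0 F -> hol0 G ->
  maj r N (fun z => F z * G z)%C <= maj r N F * maj r N G.
Proof.
  intros Hr. induction N as [|N IH]; intros F G HF HG.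
  - simpl. rewrite c0_mult, Cmod_mult by auto. lra.
  - pose proof (hol0_Sh F HF) as HSF.
    rewrite (maj_ext r (S N) _ (fun z => c0 F * G z + z * (Sh F z * G z))%C).
    2:{ intros z Hz. rewrite (Sh_eq F) by now apply Cmod_neq_0. ring. }
    eapply Rle_trans; [apply maj_scal_plus_z; auto using hol0_mult|].
    specialize (IH (Sh F) G HSF HG).
    pose proof (maj_le_S r N Hr G). pose proof (maj_ge_0 r N Hr (Sh F)).
    change (maj r (S N) F) with (Cmod (c0 F) + r * maj r N (Sh F)).
    rewrite Rmult_plus_distr_r. apply Rplus_le_compat_l.
    rewrite Rmult_assoc. apply Rmult_le_compat_l; auto.
    eapply Rle_trans; [exact IH|]. now apply Rmult_le_compat_l.
Qed.

(** * Bohr's inequality *)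

Definition m2 (F : C -> C) (rho : R) : R := rmean (fun t => Cmod (F (pt rho t)) ^ 2).

Lemma ex_RInt_circ_Cmod2 F rho : circ_cont F rho ->
  ex_RInt (fun t => Cmod (F (pt rho t)) ^ 2) 0 (2 * PI).
Proof.
  intros HF. apply (ex_RInt_continuous (V := R_CompleteNormedModule)). intros t _.
  apply (continuity_2d_snd (fun x y => Cmod (F (pt x y)) ^ 2)).
  destruct (ccont_2d F rho t (HF t)) as [HR HI].
  apply continuity_2d_pt_ext with (fun x y => Re (F (pt x y)) * Re (F (pt x y))
    + Im (F (pt x y)) * Im (F (pt x y))).
  - intros x y. rewrite Cmod2_alt. ring.
  - apply continuity_2d_pt_plus; now apply continuity_2d_pt_mult.
Qed.

Lemma m2_le F G rho : circ_cont F rho -> circ_cont G rho ->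
  (forall t, Cmod (F (pt rho t)) <= Cmod (G (pt rho t))) -> m2 F rho <= m2 G rho.
Proof.
  intros HF HG H. apply rmean_le; auto using ex_RInt_circ_Cmod2.
  intros t _. apply pow_incr. split; [apply Cmod_ge_0|auto].
Qed.

Lemma m2_ext F G rho : (forall t, F (pt rho t) = G (pt rho t)) -> m2 F rho = m2 G rho.
Proof. intros H. unfold m2. apply rmean_ext. intros t. now rewrite H. Qed.

Lemma m2_ge_0 F rho : circ_cont F rho -> 0 <= m2 F rho.
Proof.
  intros HF. rewrite <- (rmean_const 0).
  apply rmean_le; auto using ex_RInt_circ_Cmod2, ex_RInt_const_R.
  intros t _. apply pow2_ge_0.
Qed.

Lemma m2_const c rho : m2 (fun _ => c) rho = Cmod c ^ 2.
Proof. exact (rmean_const (Cmod c ^ 2)). Qed.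

Lemma Cmod2_plus (a u : C) :
  Cmod (a + u) ^ 2 = Cmod a ^ 2 + (Cmod u ^ 2 + 2 * Re (Cconj a * u)%C).
Proof. destruct a, u. rewrite !Cmod2_alt. simpl. ring. Qed.

(** The cross term is twice the mean of [Re (conj a k z H)], which vanishes because a multiple of
    [z] has constant coefficient 0. *)
Lemma m2_affine a k H rho : hol0 H -> 0 < rho < 1 ->
  m2 (fun z => a + k * (z * H z))%C rho = Cmod a ^ 2 + Cmod k ^ 2 * rho ^ 2 * m2 H rho.
Proof.
  intros HH Hr.
  set (G := fun z => (Cconj a * k * (z * H z))%C).
  assert (HzH : hol0 (fun z => z * H z)%C) by auto using hol0_mult, hol0_id.
  assert (HG : hol0 G) by now apply hol0_scal.
  pose proof (hol0_circ_cont _ _ HH Hr) as cH.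
  pose proof (hol0_circ_cont _ _ HG Hr) as cG.
  assert (E : rmean (fun t => Re (G (pt rho t))) = 0).
  { change (Re (cmean G rho) = 0). rewrite cmean_c0 by auto. unfold G.
    rewrite (c0_mult (fun _ => Cconj a * k)%C), c0_z_mult by auto using hol0_const.
    now rewrite Cmult_0_r. }
  unfold m2.
  rewrite (rmean_ext _ (fun t => Cmod a ^ 2 +
    (Cmod k ^ 2 * rho ^ 2 * Cmod (H (pt rho t)) ^ 2 + 2 * Re (G (pt rho t))))).
  2:{ intros t. rewrite Cmod2_plus, !Cmod_mult, Cmod_pt by lra. unfold G.
      replace (Cconj a * (k * (pt rho t * H (pt rho t))))%C
        with (Cconj a * k * (pt rho t * H (pt rho t)))%C by ring. ring. }
  assert (I1 := ex_RInt_circ_Cmod2 _ _ cH).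
  assert (I2 := ex_RInt_circ_Re _ _ 0 (2 * PI) cG).
  rewrite (rmean_plus (fun _ => Cmod a ^ 2)), rmean_const, rmean_plus, !rmean_scal, E
    by auto using ex_RInt_const_R, ex_RInt_plus_R, ex_RInt_scal_R.
  ring.
Qed.

Lemma m2_Sh F rho : hol0 F -> 0 < rho < 1 ->
  m2 F rho = Cmod (c0 F) ^ 2 + rho ^ 2 * m2 (Sh F) rho.
Proof.
  intros HF Hr. rewrite (m2_ext F (fun z => c0 F + 1 * (z * Sh F z))%C).
  - rewrite m2_affine by auto using hol0_Sh. rewrite Cmod_1. ring.
  - intros t. rewrite (Sh_eq F) by (apply Cmod_neq_0; rewrite Cmod_pt; lra). ring.
Qed.

Fixpoint l2 (q : R) (N : nat) (F : C -> C) : R :=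
  match N with
  | O => Cmod (c0 F) ^ 2
  | S N => Cmod (c0 F) ^ 2 + q * l2 q N (Sh F)
  end.

Lemma bessel rho N : 0 < rho < 1 -> forall F, hol0 F -> l2 (rho ^ 2) N F <= m2 F rho.
Proof.
  intros Hr. induction N as [|N IH]; intros F HF; rewrite (m2_Sh F) by auto;
    pose proof (hol0_Sh F HF) as HS; pose proof (pow2_ge_0 rho).
  - pose proof (m2_ge_0 _ _ (hol0_circ_cont _ _ HS Hr)). simpl l2. nra.
  - cbn [l2]. apply Rplus_le_compat_l. apply Rmult_le_compat_l; auto.
Qed.

Lemma l2_continuous N : forall F q, continuity_pt (fun q => l2 q N F) q.
Proof.
  induction N as [|N IH]; intros F q; cbn [l2].
  - now apply continuity_pt_const.
  - apply continuity_pt_plus; [now apply continuity_pt_const|].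
    apply continuity_pt_mult; [apply continuity_pt_id|apply IH].
Qed.

Lemma continuity_le_left f y c : continuity_pt f 1 -> (forall q, 0 < q < 1 -> f q <= c) ->
  y = f 1 -> y <= c.
Proof.
  intros Hf H ->. apply Rnot_lt_le. intros Hlt.
  destruct (Hf (f 1 - c)) as [d [Hd Hd1]]; [lra|].
  set (q := 1 - Rmin d 1 / 2).
  assert (0 < Rmin d 1) by (apply Rmin_pos; lra).
  pose proof (Rmin_l d 1). pose proof (Rmin_r d 1).
  specialize (H q ltac:(unfold q; lra)).
  assert (Hq : Rabs (f q - f 1) < f 1 - c).
  { apply (Hd1 q). split; [split; [exact I|unfold q; lra]|].
    unfold R_dist. simpl. unfold q. apply Rabs_def1; lra. }
  apply Rabs_def2 in Hq. lra.
Qed.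

Definition sub1 (F : C -> C) : Prop :=
  hol0 F /\ forall z, 0 < Cmod z < 1 -> Cmod (F z) <= 1.

(** For [q < 1] this is Bessel's inequality on the circle of radius [sqrt q]. For [q = 1] that
    circle leaves the disc, and the bound follows by continuity, a truncated sum being a polynomial
    in [q]. *)
Lemma sub1_bessel F q N : sub1 F -> 0 < q <= 1 ->
  Cmod (c0 F) ^ 2 + q * l2 q N (Sh F) <= 1.
Proof.
  intros [HF HF1].
  assert (K : forall q, 0 < q < 1 -> l2 q (S N) F <= 1).
  { clear q. intros q Hq.
    assert (Hs : 0 < sqrt q < 1).
    { split; [now apply sqrt_lt_R0|]. rewrite <- sqrt_1. apply sqrt_lt_1; lra. }
    rewrite <- (pow2_sqrt q) by lra.
    eapply Rle_trans; [now apply bessel|].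
    replace 1 with (m2 (fun _ => RtoC 1) (sqrt q)) by (rewrite m2_const, Cmod_1; ring).
    apply m2_le; [now apply hol0_circ_cont|intros t; apply ccont_const|].
    intros t. rewrite Cmod_1. apply HF1. rewrite Cmod_pt; lra. }
  intros Hq. destruct (Req_dec q 1) as [->|Hq1].
  - apply (continuity_le_left (fun q => l2 q (S N) F) _ 1 (l2_continuous _ _ _) K).
    reflexivity.
  - apply (K q). lra.
Qed.

Lemma l2_ge_0 q N : 0 <= q -> forall F, 0 <= l2 q N F.
Proof.
  intros Hq. induction N as [|N IH]; intros F; cbn [l2];
    pose proof (pow2_ge_0 (Cmod (c0 F))); auto.
  specialize (IH (Sh F)). nra.
Qed.

Lemma sub1_c0 F : sub1 F -> Cmod (c0 F) <= 1.
Proof.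
  intros HF. pose proof (sub1_bessel F 1 0 HF ltac:(lra)) as H.
  pose proof (l2_ge_0 1 0 ltac:(lra) (Sh F)). pose proof (Cmod_ge_0 (c0 F)). nra.
Qed.

Lemma moebius_bound (p a : C) : Cmod p <= 1 -> Cmod a <= 1 ->
  Cmod (a - p) <= Cmod (1 - Cconj p * a).
Proof.
  intros Hp Ha. pose proof (Cmod_ge_0 p). pose proof (Cmod_ge_0 a).
  assert (E : Cmod (1 - Cconj p * a) ^ 2 - Cmod (a - p) ^ 2
    = (1 - Cmod p ^ 2) * (1 - Cmod a ^ 2)).
  { destruct p, a. rewrite !Cmod2_alt. simpl. ring. }
  assert (0 <= (1 - Cmod p ^ 2) * (1 - Cmod a ^ 2)) by (apply Rmult_le_pos; nra).
  apply Rsqr_incr_0_var; [|apply Cmod_ge_0]. rewrite !Rsqr_pow2. lra.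
Qed.

Lemma hol0_inv F m : hol0 F -> 0 < m -> (forall z, 0 < Cmod z < 1 -> m <= Cmod (F z)) ->
  hol0 (fun z => / F z)%C.
Proof.
  intros [HF _] Hm H. split.
  - intros z Hz. apply cdiff_inv; auto. apply Cmod_neq_0. specialize (H z Hz). lra.
  - exists 1, (/ m). split; [lra|]. intros z Hz. specialize (H z Hz).
    rewrite Cmod_inv by (apply Cmod_neq_0; lra). apply Rinv_le_contravar; lra.
Qed.

(* Schwarz's lemma for [(F - p) / (1 - conj p F)], with [p = c0 F]. *)
Lemma schwarz_pick F : sub1 F -> Cmod (c0 F) < 1 -> forall z, 0 < Cmod z < 1 ->
  Cmod (Sh F z) <= Cmod (1 - Cconj (c0 F) * F z).
Proof.
  intros [HF HF1] Hp. set (p := c0 F) in *.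
  set (G := fun z => (1 + - Cconj p * F z)%C).
  assert (HG : hol0 G) by (apply hol0_plus; [apply hol0_const|now apply hol0_scal]).
  assert (EG : forall z, G z = (1 - Cconj p * F z)%C) by (intros; unfold G; ring).
  assert (HG1 : forall z, 0 < Cmod z < 1 -> 1 - Cmod p <= Cmod (G z)).
  { intros z Hz. rewrite EG.
    pose proof (Cmod_reverse_triangle 1 (Cconj p * F z)) as H.
    rewrite Cmod_1, Cmod_mult, Cmod_conj in H. specialize (HF1 z Hz).
    pose proof (Cmod_ge_0 p). pose proof (Cmod_ge_0 (F z)). nra. }
  assert (Hq : hol0 (fun z => Sh F z * / G z)%C).
  { apply hol0_mult; [now apply hol0_Sh|]. apply hol0_inv with (1 - Cmod p); auto. lra. }
  assert (HG0 : forall z, 0 < Cmod z < 1 -> G z <> RtoC 0).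
  { intros z Hz. apply Cmod_neq_0. specialize (HG1 z Hz). lra. }
  intros z Hz. rewrite <- EG.
  assert (H : Cmod (Sh F z * / G z) <= 1).
  { revert z Hz. apply schwarz; auto. intros z Hz.
    assert (Hz0 : z <> RtoC 0) by now apply Cmod_neq_0.
    replace (z * (Sh F z * / G z))%C with ((F z - p) / G z)%C
      by (unfold Sh; fold p; field; auto).
    rewrite Cmod_div by auto. specialize (HG1 z Hz).
    apply Rle_div_l; [lra|]. rewrite Rmult_1_l, EG. apply moebius_bound; [lra|auto]. }
  rewrite Cmod_mult, Cmod_inv in H by auto. specialize (HG1 z Hz).
  apply Rle_div_l in H; lra.
Qed.

(** Writing [F] through its shift turns the Schwarz-Pick bound into
    [|Sh F| <= |(1 - |p|^2) - conj p z Sh F|]. By [m2_affine] the quadratic mean of [Sh F] reappears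
    on the right with the factor [q |p|^2 < 1] and is absorbed. *)
Lemma sub1_l2_Sh F q N : sub1 F -> Cmod (c0 F) < 1 -> 0 < q < 1 ->
  l2 q N (Sh F) * (1 - q * Cmod (c0 F) ^ 2) <= (1 - Cmod (c0 F) ^ 2) ^ 2.
Proof.
  intros HF Hp Hq. pose proof (schwarz_pick F HF Hp) as HS. destruct HF as [HF _].
  pose proof (hol0_Sh F HF) as HSh. set (p := c0 F) in *.
  assert (Hs : 0 < sqrt q < 1).
  { split; [now apply sqrt_lt_R0|]. rewrite <- sqrt_1. apply sqrt_lt_1; lra. }
  set (rho := sqrt q) in *.
  assert (Eq : q = rho ^ 2) by (unfold rho; now rewrite pow2_sqrt by lra).
  assert (H : m2 (Sh F) rho <= (1 - Cmod p ^ 2) ^ 2 + Cmod p ^ 2 * rho ^ 2 * m2 (Sh F) rho).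
  { transitivity (m2 (fun z => (1 - Cconj p * p) + - Cconj p * (z * Sh F z))%C rho).
    - apply m2_le; [now apply hol0_circ_cont| |].
      + apply hol0_circ_cont; auto.
        apply hol0_plus; [apply hol0_const|]. apply hol0_scal.
        apply hol0_mult; auto using hol0_id.
      + intros t. eapply Rle_trans; [apply HS; rewrite Cmod_pt; lra|].
        rewrite (Sh_eq F) by (apply Cmod_neq_0; rewrite Cmod_pt; lra).
        fold p. right. f_equal. ring.
    - rewrite m2_affine by auto. rewrite Cmod_opp, Cmod_conj.
      replace (1 - Cconj p * p)%C with (RtoC (1 - Cmod p ^ 2)).
      + rewrite Cmod_R, <- Rsqr_pow2, <- Rsqr_abs, Rsqr_pow2. lra.
      + rewrite RtoC_minus, Cmod2_conj. ring. }
  pose proof (bessel rho N Hs (Sh F) HSh) as HB. rewrite <- Eq in HB, H.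
  pose proof (Cmod_ge_0 p).
  apply Rle_trans with (m2 (Sh F) rho * (1 - q * Cmod p ^ 2)); [|lra].
  apply Rmult_le_compat_r; [|exact HB]. nra.
Qed.

(** * Weighted Cauchy-Schwarz inequality and the admissible radii *)

Fixpoint geo (q : R) (N : nat) : R :=
  match N with O => 1 | S N => 1 + q * geo q N end.

Lemma geo_bound q N : 0 <= q < 1 -> 1 <= geo q N <= / (1 - q).
Proof.
  intros Hq. assert (H1 : 1 <= / (1 - q)).
  { rewrite <- Rinv_1 at 1. apply Rinv_le_contravar; lra. }
  induction N as [|N IH]; simpl; [lra|].
  replace (/ (1 - q)) with (1 + q * / (1 - q)) by (field; lra). nra.
Qed.

(* The weighted inequality [2 |c_k| r^k <= l |c_k|^2 q^k + (r^2 / q)^k / l], summed over [k]. *)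
Lemma maj_am_gm r q N : 0 < r -> 0 < q -> forall l F, 0 < l ->
  maj r N F <= (l * l2 q N F + geo (r ^ 2 / q) N / l) / 2.
Proof.
  intros Hr Hq.
  assert (K : forall l u, 0 < l -> u <= (l * u ^ 2 + 1 / l) / 2).
  { intros l u Hl. assert (H : 0 <= (l * u - 1) ^ 2 / l)
      by (apply Rdiv_le_0_compat; [apply pow2_ge_0|auto]).
    replace ((l * u - 1) ^ 2 / l) with (l * u ^ 2 + 1 / l - 2 * u) in H by (field; lra).
    lra. }
  induction N as [|N IH]; intros l F Hl; cbn [maj l2 geo].
  - now apply K.
  (* Passing to the shift multiplies the weight by [q / r], which is why [l] varies in the
     induction. *)
  - specialize (IH (l * q / r) (Sh F)). specialize (K l (Cmod (c0 F)) Hl).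
    assert (Hl2 : 0 < l * q / r) by (apply Rdiv_lt_0_compat; [nra|auto]).
    specialize (IH Hl2).
    apply (Rmult_le_compat_l r) in IH; [|lra].
    replace (r * ((l * q / r * l2 q N (Sh F) + geo (r ^ 2 / q) N / (l * q / r)) / 2))
      with ((l * (q * l2 q N (Sh F)) + (r ^ 2 / q * geo (r ^ 2 / q) N) / l) / 2) in IH
      by (field; lra).
    unfold Rdiv in *. lra.
Qed.

(** The case [q = 1]. The squares sum to at most [(1 - x) (1 + x)], so Cauchy-Schwarz bounds the
    tail by [1 - x] once [(1 + x) r^2 <= (1 - x) (1 - r^2)], which is the hypothesis on [r]. *)
Lemma bohr_small_c0 F r N : sub1 F -> 0 < r < 1 -> 2 * r ^ 2 <= 1 - Cmod (c0 F) ->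
  maj r (S N) F <= 1.
Proof.
  intros HF Hr Hx. pose proof (sub1_bessel F 1 N HF ltac:(lra)) as HB.
  pose proof (Cmod_ge_0 (c0 F)) as Hx0. cbn [maj]. set (x := Cmod (c0 F)) in *.
  (* With this weight, each of the two terms that are averaged is at most [1 - x]. *)
  assert (Hl : 0 < / (r * (1 + x))) by (apply Rinv_0_lt_compat; nra).
  pose proof (maj_am_gm r 1 N ltac:(lra) ltac:(lra) _ (Sh F) Hl) as H.
  replace (r ^ 2 / 1) with (r ^ 2) in H by field.
  assert (Hr2 : 0 < r ^ 2 < 1) by nra.
  pose proof (geo_bound (r ^ 2) N ltac:(lra)) as Hg.
  set (g := geo (r ^ 2) N) in *. set (L := l2 1 N (Sh F)) in *.
  apply (Rmult_le_compat_l r) in H; [|lra].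
  replace (r * ((/ (r * (1 + x)) * L + g / / (r * (1 + x))) / 2))
    with ((L / (1 + x) + r ^ 2 * (1 + x) * g) / 2) in H by (field; lra).
  assert (H1 : L / (1 + x) <= 1 - x) by (apply Rle_div_l; nra).
  assert (H2 : r ^ 2 * (1 + x) * g <= 1 - x).
  { apply Rle_trans with (r ^ 2 * (1 + x) * / (1 - r ^ 2)).
    - apply Rmult_le_compat_l; [nra|lra].
    - apply Rle_div_l; nra. }
  lra.
Qed.

(** The choice [q = r / x] makes [q x^2] and [r^2 / q] both equal to [r x], so that the same
    denominator [1 - r x] occurs in both factors. The condition [r < x] says [q < 1]. *)
Lemma bohr_large_c0 F r N : sub1 F -> Cmod (c0 F) < 1 -> 0 < r < Cmod (c0 F) ->
  r * (1 + 2 * Cmod (c0 F)) <= 1 -> maj r (S N) F <= 1.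
Proof.
  intros HF Hx Hr Hr1.
  assert (Hq : 0 < r / Cmod (c0 F) < 1).
  { split; [apply Rdiv_lt_0_compat; lra|]. apply Rlt_div_l; lra. }
  pose proof (sub1_l2_Sh F _ N HF Hx Hq) as HB.
  cbn [maj]. set (x := Cmod (c0 F)) in *. set (L := l2 (r / x) N (Sh F)) in *.
  replace (1 - r / x * x ^ 2) with (1 - r * x) in HB by (field; lra).
  assert (Hx2 : 0 < 1 - x ^ 2) by nra.
  assert (Hrx : 0 <= r * x < 1) by nra.
  (* This weight gives the two averaged terms the same bound [k], defined below. *)
  assert (Hl : 0 < / (1 - x ^ 2)) by now apply Rinv_0_lt_compat.
  pose proof (maj_am_gm r _ N ltac:(lra) (proj1 Hq) _ (Sh F) Hl) as H. fold L in H.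
  replace (r ^ 2 / (r / x)) with (r * x) in H by (field; lra).
  pose proof (geo_bound (r * x) N Hrx) as Hg. set (g := geo (r * x) N) in *.
  apply Rle_div_r in HB; [|lra].
  set (k := (1 - x ^ 2) / (1 - r * x)).
  assert (H1 : / (1 - x ^ 2) * L <= k).
  { replace k with (/ (1 - x ^ 2) * ((1 - x ^ 2) ^ 2 / (1 - r * x)))
      by (unfold k; field; lra).
    apply Rmult_le_compat_l; lra. }
  assert (H2 : g / / (1 - x ^ 2) <= k).
  { unfold k, Rdiv. rewrite Rinv_inv, Rmult_comm. apply Rmult_le_compat_l; lra. }
  (* After division by [1 - x] this is [r (1 + x) <= 1 - r x], the hypothesis on [r]. *)
  assert (H3 : r * k <= 1 - x).
  { unfold k. replace (r * ((1 - x ^ 2) / (1 - r * x)))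
      with (r * (1 - x ^ 2) / (1 - r * x)) by (field; lra).
    apply Rle_div_l; [lra|].
    replace (r * (1 - x ^ 2)) with ((1 - x) * (r * (1 + x))) by ring.
    apply Rmult_le_compat_l; lra. }
  assert (r * maj r N (Sh F) <= r * k) by (apply Rmult_le_compat_l; lra).
  lra.
Qed.

(** Bessel's inequality leaves nothing for the higher coefficients. The case is separate because
    [schwarz_pick] divides by [1 - conj p F], which is bounded below only for [|p| < 1]. *)
Lemma bohr_unimodular_c0 F r N : sub1 F -> Cmod (c0 F) = 1 -> 0 < r < 1 ->
  maj r (S N) F <= 1.
Proof.
  intros HF Hx Hr. pose proof (sub1_bessel F 1 N HF ltac:(lra)) as HB.
  cbn [maj]. rewrite Hx in *.
  assert (Hr2 : 0 < r ^ 2 < 1) by nra.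
  pose proof (geo_bound (r ^ 2) N ltac:(lra)) as Hg.
  assert (Hm : maj r N (Sh F) <= 0); [|nra].
  apply Rnot_lt_le. intros Hm. set (m := maj r N (Sh F)) in *.
  (* This weight turns [maj_am_gm] into [m <= m / 2]. *)
  assert (Hl : 0 < geo (r ^ 2) N / m) by (apply Rdiv_lt_0_compat; lra).
  pose proof (maj_am_gm r 1 N ltac:(lra) ltac:(lra) _ (Sh F) Hl) as H. fold m in H.
  replace (r ^ 2 / 1) with (r ^ 2) in H by field.
  replace (geo (r ^ 2) N / (geo (r ^ 2) N / m)) with m in H by (field; lra).
  assert (l2 1 N (Sh F) <= 0) by lra. nra.
Qed.

Lemma r1_lt_1 x : 0 <= x -> r1 x < 1.
Proof.
  intros Hx. unfold r1. destruct Rlt_dec.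
  - replace 1 with (sqrt 1) at 2 by apply sqrt_1. apply sqrt_lt_1; lra.
  - apply Rlt_div_l; lra.
Qed.

Lemma bohr F r N : sub1 F -> 0 <= r <= r1 (Cmod (c0 F)) -> maj r N F <= 1.
Proof.
  intros HF Hr. pose proof (sub1_c0 F HF) as Hx. pose proof (Cmod_ge_0 (c0 F)) as Hx0.
  pose proof (r1_lt_1 _ Hx0) as Hr1. assert (Hlt : r < 1) by lra.
  destruct N as [|N]; [exact Hx|].
  destruct (Req_dec r 0) as [->|Hr0]; [simpl; lra|].
  (* The split is on this inequality rather than on the branch of [r1]: it always holds for
     [x < 1 / 2], and its failure for [x >= 1 / 2] forces [r < x]. *)
  destruct (Rle_dec (2 * r ^ 2) (1 - Cmod (c0 F))) as [H|H].
  { apply bohr_small_c0; auto. lra. }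
  unfold r1 in Hr. destruct Rlt_dec as [Hh|Hh].
  - exfalso. apply H.
    assert (r * r <= sqrt ((1 - Cmod (c0 F)) / 2) * sqrt ((1 - Cmod (c0 F)) / 2))
      by (apply Rmult_le_compat; lra).
    rewrite sqrt_sqrt in H0 by lra. lra.
  - destruct Hr as [Hr Hr2]. apply Rle_div_r in Hr2; [|lra].
    destruct (Req_dec (Cmod (c0 F)) 1) as [H1|H1].
    + apply bohr_unimodular_c0; auto. lra.
    + apply bohr_large_c0; auto; [lra|]. split; [lra|].
      apply Rnot_le_lt. intros Hle. apply H. nra.
Qed.

(** * Power series and quasi-subordination *)

Lemma is_series_C_eps (u : nat -> C) (l : C) :
  is_series (K := C_AbsRing) (V := C_NormedModule) u l -> forall eps, 0 < eps ->
  exists N, forall n, (N <= n)%nat ->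
    Cmod (sum_n (G := C_AbelianMonoid) u n - l) < eps.
Proof.
  intros H eps Heps.
  destruct (proj1 (filterlim_locally_ball_norm (K := C_AbsRing) (U := C_NormedModule) _ _) H
    (mkposreal _ Heps)) as [N HN]. exists N. exact HN.
Qed.

Lemma is_series_C_bounded (u : nat -> C) (l : C) :
  is_series (K := C_AbsRing) (V := C_NormedModule) u l ->
  exists M, forall n, Cmod (u n) <= M.
Proof.
  intros H. destruct (is_series_C_eps u l H 1 Rlt_0_1) as [N HN].
  assert (K : exists M, forall n, (n <= N)%nat -> Cmod (u n) <= M).
  { clear. induction N as [|N [M HM]].
    - exists (Cmod (u 0%nat)). intros n Hn. replace n with 0%nat by lia. lra.
    - exists (Rmax M (Cmod (u (S N)))). intros n Hn.
      destruct (Nat.eq_dec n (S N)) as [->|Hne]; [apply Rmax_r|].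
      eapply Rle_trans; [apply HM; lia|apply Rmax_l]. }
  destruct K as [M HM]. exists (Rmax M 2). intros n.
  destruct (Nat.le_gt_cases n N) as [Hn|Hn].
  - eapply Rle_trans; [now apply HM|apply Rmax_l].
  - eapply Rle_trans; [|apply Rmax_r]. destruct n as [|n]; [lia|].
    pose proof (HN n ltac:(lia)) as H1. pose proof (HN (S n) ltac:(lia)) as H2.
    rewrite sum_Sn in H2. change plus with Cplus in H2.
    set (s := sum_n (G := C_AbelianMonoid) u n) in *.
    replace (u (S n)) with ((s + u (S n) - l) - (s - l))%C by ring.
    pose proof (Cmod_triangle_minus (s + u (S n) - l) (s - l)). lra.
Qed.

Lemma Cmod_pow_n (z : C) k : Cmod (pow_n (K := C_Ring) z k) = Cmod z ^ k.
Proof.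
  induction k as [|k IH]; simpl; [apply Cmod_1|].
  change (Cmod (z * pow_n (K := C_Ring) z k) = Cmod z * Cmod z ^ k).
  now rewrite Cmod_mult, IH.
Qed.

Lemma has_expansion_coeff_bound h c rho : has_expansion h c -> 0 <= rho < 1 ->
  exists M, forall k, Cmod (c k) * rho ^ k <= M.
Proof.
  intros H Hr.
  assert (Hz : Cmod rho = rho) by (rewrite Cmod_R; now apply Rabs_pos_eq).
  specialize (H rho ltac:(lra)). apply is_series_C_bounded in H.
  destruct H as [M HM]. exists M. intros k. specialize (HM k).
  change (Cmod (pow_n (K := C_Ring) (RtoC rho) k * c k) <= M) in HM.
  rewrite Cmod_mult, Cmod_pow_n, Hz in HM. lra.
Qed.

(** Coefficient bounds at radius [3 / 4] give decay with ratio [2 / 3] for [|z| <= 1 / 2], hence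
    partial sums below [3 M]; the [+ 1] is the distance from a partial sum to [h z]. *)
Lemma has_expansion_loc_bound h c : has_expansion h c ->
  exists M, 0 <= M /\ forall z, Cmod z <= 1 / 2 -> Cmod (h z) <= M.
Proof.
  intros H. destruct (has_expansion_coeff_bound h c (3 / 4) H ltac:(lra)) as [M HM].
  assert (HM0 : 0 <= M).
  { eapply Rle_trans; [|apply (HM 0%nat)]. simpl. rewrite Rmult_1_r. apply Cmod_ge_0. }
  exists (3 * M + 1). split; [lra|]. intros z Hz. pose proof (Cmod_ge_0 z) as Hz0.
  assert (K : forall n, Cmod (sum_n (G := C_AbelianMonoid)
      (fun k => scal (K := C_AbsRing) (V := C_NormedModule) (pow_n (K := C_Ring) z k) (c k)) n)
      <= 3 * M * (1 - (2 / 3) ^ S n)).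
  { assert (T : forall k, Cmod (scal (K := C_AbsRing) (V := C_NormedModule)
        (pow_n (K := C_Ring) z k) (c k)) <= M * (2 / 3) ^ k).
    { intros k. change (Cmod (pow_n (K := C_Ring) z k * c k) <= M * (2 / 3) ^ k).
      rewrite Cmod_mult, Cmod_pow_n.
      apply Rle_trans with ((1 / 2) ^ k * Cmod (c k)).
      - apply Rmult_le_compat_r; [apply Cmod_ge_0|]. apply pow_incr. lra.
      - replace (1 / 2) with (3 / 4 * (2 / 3)) by field. rewrite Rpow_mult_distr.
        specialize (HM k). assert (0 <= (2 / 3) ^ k) by (apply pow_le; lra). nra. }
    induction n as [|n IH].
    - rewrite sum_O. specialize (T 0%nat). simpl in *. lra.
    - rewrite sum_Sn. change plus with Cplus.
      eapply Rle_trans; [apply Cmod_triangle|]. specialize (T (S n)).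
      change ((2 / 3) ^ S (S n)) with (2 / 3 * (2 / 3) ^ S n). lra. }
  destruct (is_series_C_eps _ _ (H z ltac:(lra)) 1 Rlt_0_1) as [N HN].
  specialize (HN N (Nat.le_refl N)). specialize (K N).
  rewrite Cmod_minus_sym in HN.
  pose proof (Cmod_reverse_triangle (h z) (sum_n (G := C_AbelianMonoid)
      (fun k => scal (K := C_AbsRing) (V := C_NormedModule) (pow_n (K := C_Ring) z k) (c k)) N)).
  assert (0 < (2 / 3) ^ S N) by (apply pow_lt; lra).
  assert (0 <= M * (2 / 3) ^ S N) by nra.
  (* [HN] and [K] carry syntactically different structures on [C]. *)
  change (pow_n (K := C_Ring)) with (pow_n (K := C_AbsRing)) in *.
  change (sum_n (G := C_AbelianMonoid))
    with (sum_n (G := NormedModule.AbelianMonoid _ C_NormedModule)) in *.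
  lra.
Qed.

(** Unlike [Sh], this shift has the correct value at 0, because it is evaluated at [omega z], which
    may vanish although [z] does not. *)
Definition shift_fun (h : C -> C) (c : nat -> C) : C -> C := fun z =>
  if Ceq_dec z 0 then c 1%nat else ((h z - c 0%nat) / z)%C.

Lemma shift_fun_expansion h c : has_expansion h c ->
  has_expansion (shift_fun h c) (fun k => c (S k)).
Proof.
  intros H z Hz. unfold shift_fun. destruct (Ceq_dec z 0) as [->|Hz0].
  - apply (is_pseries_0 (K := C_AbsRing) (V := C_NormedModule) (fun k => c (S k))).
  - replace ((h z - c 0%nat) / z)%C with (/ z * (h z - c 0%nat))%C by (field; auto).
    apply (is_pseries_decr_1 (K := C_AbsRing) (V := C_NormedModule) c z (/ z)%C (h z)).
    + change (/ z * z = 1)%C. field. auto.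
    + now apply H.
Qed.

Lemma has_expansion_0 h c : has_expansion h c -> h (RtoC 0) = c 0%nat.
Proof.
  intros H. specialize (H (RtoC 0) ltac:(rewrite Cmod_0; lra)).
  apply (filterlim_locally_unique (K := C_AbsRing) (V := C_NormedModule) _ _ _ H
   (is_pseries_0 (K := C_AbsRing) (V := C_NormedModule) c)).
Qed.

Lemma has_expansion_shift_eq h c z : has_expansion h c ->
  h z = (c 0%nat + z * shift_fun h c z)%C.
Proof.
  intros H. unfold shift_fun. destruct (Ceq_dec z 0) as [->|Hz0].
  - rewrite (has_expansion_0 h c H). ring.
  - field. auto.
Qed.

Lemma has_expansion_lipschitz_0 h c : has_expansion h c ->
  exists M, 0 <= M /\ forall z, Cmod z <= 1 / 2 -> Cmod (h z - c 0%nat) <= M * Cmod z.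
Proof.
  intros H. destruct (has_expansion_loc_bound _ _ (shift_fun_expansion h c H)) as [M [HM0 HM]].
  exists M. split; auto. intros z Hz. rewrite (has_expansion_shift_eq h c z H).
  replace (c 0%nat + z * shift_fun h c z - c 0%nat)%C with (shift_fun h c z * z)%C by ring.
  rewrite Cmod_mult. apply Rmult_le_compat_r; [apply Cmod_ge_0|auto].
Qed.

Lemma lipschitz_lim0 F c M : 0 <= M ->
  (forall z, 0 < Cmod z <= 1 / 2 -> Cmod (F z - c) <= M * Cmod z) -> lim0 F c.
Proof.
  intros HM0 HM eps Heps.
  assert (Hp : 0 < eps / (M + 1)) by (apply Rdiv_lt_0_compat; lra).
  exists (Rmin (1 / 2) (eps / (M + 1))). split; [apply Rmin_pos; lra|].
  intros z Hz. pose proof (Rmin_l (1 / 2) (eps / (M + 1))).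
  pose proof (Rmin_r (1 / 2) (eps / (M + 1))).
  eapply Rle_trans; [apply HM; lra|].
  replace eps with ((M + 1) * (eps / (M + 1))) by (field; lra).
  apply Rmult_le_compat; lra.
Qed.

Lemma has_expansion_ccont_0 h c : has_expansion h c -> ccont h 0.
Proof.
  intros H. destruct (has_expansion_lipschitz_0 h c H) as [M [HM0 HM]].
  assert (L : lim0 h (c 0%nat)).
  { apply lipschitz_lim0 with M; auto. intros z Hz. apply HM. lra. }
  intros eps Heps. destruct (L (eps / 2)) as [d [Hd Hd1]]; [lra|].
  exists d. split; auto. intros w Hw. rewrite Cmod_minus_0 in Hw.
  rewrite (has_expansion_0 h c H).
  destruct (Ceq_dec w 0) as [->|Hw0].
  - rewrite (has_expansion_0 h c H).
    replace (c 0%nat - c 0%nat)%C with (RtoC 0) by ring. now rewrite Cmod_0.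
  - apply Cmod_gt_0 in Hw0. specialize (Hd1 w ltac:(lra)). lra.
Qed.

Definition expands (h : C -> C) (c : nat -> C) : Prop :=
  (forall z, Cmod z < 1 -> cdiff h z) /\ has_expansion h c.

Lemma expands_shift h c : expands h c -> expands (shift_fun h c) (fun k => c (S k)).
Proof.
  intros [Hd H]. pose proof (shift_fun_expansion h c H) as H1. split; auto.
  intros z Hz. destruct (Ceq_dec z 0) as [->|Hz0].
  (* At 0 the slope function of the shift is the second shift. *)
  - exists (shift_fun (shift_fun h c) (fun k => c (S k))). split.
    + apply (has_expansion_ccont_0 _ _ (shift_fun_expansion _ _ H1)).
    + exists 1. split; [lra|]. intros w _.
      rewrite (has_expansion_0 _ _ H1), (has_expansion_shift_eq _ _ w H1). ring.
  - pose proof (proj1 (Cmod_gt_0 z) Hz0) as Hz1.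
    apply cdiff_ext_loc with (fun w => (h w - c 0%nat) / w)%C (Cmod z); auto.
    + intros w Hw. unfold shift_fun. destruct (Ceq_dec w 0) as [->|]; auto.
      rewrite Cmod_minus_sym, Cmod_minus_0 in Hw. lra.
    + apply cdiff_div; auto; [|apply cdiff_id].
      apply cdiff_minus; [auto|apply cdiff_const].
Qed.

Lemma expands_hol0 h c : expands h c -> hol0 h.
Proof.
  intros [Hd H]. split; [intros; apply Hd; lra|].
  destruct (has_expansion_loc_bound h c H) as [M [_ HM]].
  exists (1 / 2), M. split; [lra|]. intros z Hz. apply HM. lra.
Qed.

Lemma expands_c0 h c : expands h c -> c0 h = c 0%nat.
Proof.
  intros H. apply lim0_unique with h; [apply hol0_lim0, (expands_hol0 h c H)|].
  destruct (has_expansion_lipschitz_0 h c (proj2 H)) as [M [HM0 HM]].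
  apply lipschitz_lim0 with M; auto. intros z Hz. apply HM. lra.
Qed.

(** Horner form, to match the recursion of [maj]. *)
Fixpoint coeff_sum (r : R) (N : nat) (c : nat -> C) : R :=
  match N with
  | O => Cmod (c O)
  | S N => Cmod (c O) + r * coeff_sum r N (fun k => c (S k))
  end.

Lemma coeff_sum_eq r N : forall c,
  coeff_sum r N c = sum_n (fun k => Cmod (c k) * r ^ k) N.
Proof.
  induction N as [|N IH]; intros c; rewrite sum_n_Reals.
  - simpl. ring.
  - rewrite decomp_sum by lia. simpl. rewrite IH, sum_n_Reals, scal_sum, Rmult_1_r.
    f_equal. apply sum_eq. intros; ring.
Qed.

Lemma maj_expands r N : forall h c, expands h c -> maj r N h = coeff_sum r N c.
Proof.
  induction N as [|N IH]; intros h c H; simpl; rewrite (expands_c0 h c H); auto.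
  rewrite (maj_ext r N _ (shift_fun h c)); [now rewrite (IH _ _ (expands_shift h c H))|].
  intros z Hz. unfold Sh, shift_fun. rewrite (expands_c0 h c H).
  destruct (Ceq_dec z 0) as [->|]; auto. rewrite Cmod_0 in Hz. lra.
Qed.

(** Each step replaces the multiplier [Phi] by [psi Phi]. The induction therefore ranges over all
    [Phi] with majorant sums at most 1, a class stable under multiplication by [psi] thanks to
    [maj_mult]. *)
Lemma maj_quasi_subordinate r omega psi N : 0 <= r ->
  (forall z, 0 < Cmod z < 1 -> cdiff omega z) ->
  (forall z, 0 < Cmod z < 1 -> omega z = (z * psi z)%C) -> sub1 psi ->
  (forall n, maj r n psi <= 1) -> forall Phi g b, hol0 Phi ->
  (forall n, maj r n Phi <= 1) -> expands g b ->
  maj r N (fun z => Phi z * g (omega z))%C <= coeff_sum r N b.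
Proof.
  intros Hr Hod Ho [Hpsi Hpsi1] Hmpsi.
  assert (Ho1 : forall z, 0 < Cmod z < 1 -> Cmod (omega z) <= Cmod z).
  { intros z Hz. rewrite (Ho z Hz), Cmod_mult. specialize (Hpsi1 z Hz). nra. }
  (* As [|omega z| <= |z|], the Lipschitz bound of [g] at 0 passes to the composition. *)
  assert (Hgo : forall g b, expands g b ->
    hol0 (fun z => g (omega z)) /\ c0 (fun z => g (omega z)) = b 0%nat).
  { intros g b [Hgd Hg].
    destruct (has_expansion_lipschitz_0 g b Hg) as [M [HM0 HM]].
    assert (HM1 : forall z, 0 < Cmod z <= 1 / 2 ->
      Cmod (g (omega z) - b 0%nat) <= M * Cmod z).
    { intros z Hz. specialize (Ho1 z ltac:(lra)).
      eapply Rle_trans; [apply HM; lra|]. now apply Rmult_le_compat_l. }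
    assert (Hh : hol0 (fun z => g (omega z))).
    { split.
      - intros z Hz. apply cdiff_comp; auto. apply Hgd. specialize (Ho1 z Hz). lra.
      - exists (1 / 2), (Cmod (b 0%nat) + M). split; [lra|]. intros z Hz.
        specialize (HM1 z ltac:(lra)).
        pose proof (Cmod_reverse_triangle (g (omega z)) (b 0%nat)). nra. }
    split; auto. apply lim0_unique with (fun z => g (omega z)); [now apply hol0_lim0|].
    now apply lipschitz_lim0 with M. }
  induction N as [|N IH]; intros Phi g b HPhi HmPhi Hg.
  - simpl. destruct (Hgo g b Hg) as [H1 H2].
    rewrite c0_mult, H2, Cmod_mult by auto. specialize (HmPhi 0%nat). simpl in HmPhi.
    pose proof (Cmod_ge_0 (b 0%nat)). nra.
  - pose proof (expands_shift g b Hg) as Hg1.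
    set (G := fun z => (psi z * Phi z * shift_fun g b (omega z))%C).
    assert (HG : hol0 G).
    { apply hol0_mult; [now apply hol0_mult|]. apply (Hgo _ _ Hg1). }
    rewrite (maj_ext r (S N) _ (fun z => b 0%nat * Phi z + z * G z)%C).
    2:{ intros z Hz. rewrite (has_expansion_shift_eq g b (omega z) (proj2 Hg)).
        unfold G. rewrite (Ho z Hz) at 1. ring. }
    eapply Rle_trans; [now apply maj_scal_plus_z|].
    cbn [coeff_sum]. apply Rplus_le_compat.
    + pose proof (Cmod_ge_0 (b 0%nat)). specialize (HmPhi (S N)). nra.
    + apply Rmult_le_compat_l; auto. apply IH; auto using hol0_mult.
      intros n. eapply Rle_trans; [now apply maj_mult|].
      pose proof (maj_ge_0 r n Hr psi). pose proof (maj_ge_0 r n Hr Phi).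
      specialize (Hmpsi n). specialize (HmPhi n). nra.
Qed.

(** * The functions of class B and the passage to infinite sums *)

Lemma class_B_sub1 Phi : class_B Phi -> sub1 Phi /\ c0 Phi = Phi 0.
Proof.
  intros [Hd H1].
  assert (HPhi : hol0 Phi).
  { split; [intros; apply ex_derive_cdiff, Hd; lra|].
    exists 1, 1. split; [lra|]. intros; apply H1; lra. }
  split; [split; auto; intros; apply H1; lra|].
  apply lim0_unique with Phi; [now apply hol0_lim0|].
  pose proof (cdiff_ccont _ _ (ex_derive_cdiff _ _ (Hd (RtoC 0) ltac:(rewrite Cmod_0; lra)))) as Hc.
  intros eps Heps. destruct (Hc eps Heps) as [d [Hd0 Hd1]]. exists d. split; auto.
  intros z Hz. left. apply Hd1. rewrite Cmod_minus_0. lra.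
Qed.

Lemma class_B_schwarz_quotient omega : class_B omega -> omega (RtoC 0) = RtoC 0 ->
  sub1 (fun z => omega z / z)%C /\
  c0 (fun z => omega z / z)%C = C_derive omega (RtoC 0).
Proof.
  intros [Hd H1] H0.
  assert (Hder := C_derive_correct omega 0 (RtoC 0) (Hd (RtoC 0) ltac:(rewrite Cmod_0; lra))).
  apply is_derive_quotient_lim in Hder. set (l := C_derive omega 0) in *.
  assert (L : lim0 (fun z => omega z / z)%C l).
  { intros eps Heps. destruct (Hder eps Heps) as [d [Hd0 Hd1]]. exists d. split; auto.
    intros z Hz. specialize (Hd1 z). rewrite Cmod_minus_0 in Hd1.
    specialize (Hd1 ltac:(lra)).
    destruct (Ceq_dec 0 0) as [_|n]; [|now elim n].
    assert (Hz0 : z <> RtoC 0) by now apply Cmod_neq_0.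
    destruct (Ceq_dec z 0) as [|_]; [easy|]. rewrite H0 in Hd1.
    replace (omega z / z)%C with ((omega z - 0) / (z - 0))%C; [lra|].
    f_equal; [|f_equal]; ring. }
  assert (Hh : hol0 (fun z => omega z / z)%C).
  { split.
    - intros z Hz. apply cdiff_div; [now apply Cmod_neq_0| |apply cdiff_id].
      apply ex_derive_cdiff, Hd. lra.
    - destruct (L 1 Rlt_0_1) as [d [Hd0 Hd1]]. exists d, (Cmod l + 1). split; auto.
      intros z Hz. specialize (Hd1 z Hz).
      pose proof (Cmod_reverse_triangle (omega z / z) l). lra. }
  split.
  - split; auto. apply schwarz; auto. intros z Hz.
    replace (z * (omega z / z))%C with (omega z); [apply H1; lra|].
    field. now apply Cmod_neq_0.
  - apply lim0_unique with (fun z => omega z / z)%C; auto. now apply hol0_lim0.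
Qed.

(** [Series] is meaningful only for convergent sums; [u] converges because its partial sums increase
    and stay below [Series v]. *)
Lemma Series_le_partial_sums (u v : nat -> R) : (forall n, 0 <= u n) -> (forall n, 0 <= v n) ->
  ex_series v -> (forall N, sum_n u N <= sum_n v N) -> Series u <= Series v.
Proof.
  intros Hu Hv Hex H.
  assert (Hincr : forall w : nat -> R, (forall n, 0 <= w n) ->
    forall n, sum_n w n <= sum_n w (S n)).
  { intros w Hw n. rewrite sum_Sn. unfold plus; simpl. specialize (Hw (S n)). lra. }
  pose proof (Series_correct v Hex) as Hlv.
  assert (Hub : forall N, sum_n u N <= Series v).
  { intros N. eapply Rle_trans; [apply H|].
    apply (is_lim_seq_incr_compare (sum_n v) (Series v) Hlv (Hincr v Hv)). }
  assert (Hexu : ex_finite_lim_seq (sum_n u)).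
  { apply ex_finite_lim_seq_incr with (Series v); auto. }
  apply Lim_seq_correct' in Hexu.
  exact (is_lim_seq_le (sum_n u) (fun _ => Series v) (Series u) (Series v) Hub Hexu
    (is_lim_seq_const _)).
Qed.

(** Coefficient bounds at the intermediate radius [(1 + r) / 2] give a geometric majorant. *)
Lemma has_expansion_ex_series h c r : has_expansion h c -> 0 <= r < 1 ->
  ex_series (fun k => Cmod (c k) * r ^ k).
Proof.
  intros H Hr.
  destruct (has_expansion_coeff_bound h c ((1 + r) / 2) H ltac:(lra)) as [M HM].
  set (q := r / ((1 + r) / 2)).
  assert (Hq : 0 <= q < 1).
  { unfold q. split; [apply Rdiv_le_0_compat; lra|apply Rlt_div_l; lra]. }
  apply (ex_series_le (K := R_AbsRing) (V := R_CompleteNormedModule) _ (fun k => M * q ^ k)).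
  - intros k. change (Rabs (Cmod (c k) * r ^ k) <= M * q ^ k).
    rewrite Rabs_pos_eq by (apply Rmult_le_pos; [apply Cmod_ge_0|apply pow_le; lra]).
    replace r with ((1 + r) / 2 * q) at 1 by (unfold q; field; lra).
    rewrite Rpow_mult_distr, <- Rmult_assoc.
    apply Rmult_le_compat_r; [apply pow_le; lra|apply HM].
  - apply (ex_series_scal (K := R_AbsRing) (V := R_NormedModule) M (fun k => q ^ k)).
    apply ex_series_geom. rewrite Rabs_pos_eq; lra.
Qed.

Theorem theorem2 (f g Phi omega : C -> C) (a b : nat -> C)
  (hf : analytic_in_disc f) (hfa : has_expansion f a)
  (hg : analytic_in_disc g) (hgb : has_expansion g b)
  (hPhi : class_B Phi)
  (homega : class_B omega) (homega0 : omega (RtoC 0) = RtoC 0)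
  (hfg : forall z : C, Cmod z < 1 -> f z = Cmult (Phi z) (g (omega z))) :
  forall r : R,
    0 <= r <= Rmin (r1 (Cmod (Phi (RtoC 0)))) (r1 (Cmod (C_derive omega (RtoC 0)))) ->
    Series (fun k : nat => Cmod (a k) * r ^ k)
      <= Series (fun k : nat => Cmod (b k) * r ^ k).
Proof.
  intros r [Hr0 Hr].
  destruct (class_B_sub1 Phi hPhi) as [HPhi EPhi].
  destruct (class_B_schwarz_quotient omega homega homega0) as [Hpsi Epsi].
  pose proof (Rmin_l (r1 (Cmod (Phi 0))) (r1 (Cmod (C_derive omega 0)))) as Hr1.
  pose proof (Rmin_r (r1 (Cmod (Phi 0))) (r1 (Cmod (C_derive omega 0)))) as Hr2.
  pose proof (r1_lt_1 _ (Cmod_ge_0 (Phi 0))) as Hlt.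
  assert (Ef : expands f a) by (split; auto; intros; now apply ex_derive_cdiff, hf).
  assert (Eg : expands g b) by (split; auto; intros; now apply ex_derive_cdiff, hg).
  assert (Hnn : forall (c : nat -> C) k, 0 <= Cmod (c k) * r ^ k).
  { intros c k. apply Rmult_le_pos; [apply Cmod_ge_0|now apply pow_le]. }
  apply Series_le_partial_sums; auto.
  - apply has_expansion_ex_series with g; auto. lra.
  - intros N. rewrite <- !coeff_sum_eq, <- (maj_expands r N f a Ef).
    rewrite (maj_ext r N f (fun z => Phi z * g (omega z))%C) by (intros z Hz; apply hfg; lra).
    apply maj_quasi_subordinate with (fun z => omega z / z)%C; auto.
    + intros z Hz. apply ex_derive_cdiff, homega. lra.
    + intros z Hz. field. now apply Cmod_neq_0.
    + intros n. apply bohr; auto. rewrite Epsi. lra.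
    + apply HPhi.
    + intros n. apply bohr; auto. rewrite EPhi. lra.
Qed.
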